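(* Let $\alpha\in(0,\pi)$, $N\ge2$ and $d=d_N^+$ or $d=d_N^-$. Let $$\Theta=\begin{cases}(\theta_N,\pi-\theta_N)&\text{if }N\text{ is even},\\(\theta_{N-2},\pi-\theta_N)&\text{if }N\text{ is odd and }d_1=1,\\(\theta_N,\pi-\theta_{N-2})&\text{if }N\text{ is odd and }d_1=-1.\end{cases}$$ 1. If $\alpha\in\Theta$, then $\inf_{A_N}W(\,\cdot\,,d)>-\infty$. 2. If $N\ge3$ and $\alpha\notin\overline\Theta$, then $\inf_{A_N}W(\,\cdot\,,d)=-\infty$. 3. Suppose that $N=3$. If $d_1\cos\alpha\in(-\frac79,-\frac13)$, then $W(\,\cdot\,,d)$ has a critical point in $A_3$ that is unique up to translation ($a\mapsto(a_1+t,a_2+t,a_3+t)$, $t\in\mathbb{R}$), and it is not a minimiser. If $d_1\cos\alpha\notin(-\frac79,-\frac13)$, then $W(\,\cdot\,,d)$ has no critical point. 4. Suppose that $N\ge2$ and $d_1\cos\alpha\ge0$ or $d_N\cos\alpha\ge0$. Then $W(\,\cdot\,,d)$ has no critical point (and thus no minimisers). In particular, this is always the case if $N$ is even.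
   Context: $d_N^+=(1,-1,1,\dots,\pm1)$ and $d_N^-=(-1,1,-1,\dots,\pm1)$ in $\{\pm1\}^N$ are the alternating sign vectors starting with $1$ and $-1$, respectively. $\theta_0=\theta_1=\theta_2=0$, and for $N\ge3$, $\theta_N=\arccos\left(\frac{\sqrt{N+1}-1}{N}\right)$ if $N$ is odd, $\theta_N=\arccos\left(\frac{\sqrt N-1}{N-1}\right)$ if $N$ is even. $A_N=\{a\in\mathbb{R}^N:a_1<\dots<a_N\}$ (an open subset of $\mathbb{R}^N$; critical points are with respect to $a\in A_N$). For $a\in A_N$ and $d\in\{\pm1\}^N$, put $\gamma_n=d_n-\cos\alpha$, $$I(t)=\int_0^\infty\frac{se^{-s}}{s^2+t^2}\,ds\ (t>0),\qquad I_0=\int_0^\infty e^{-s}\log s\,ds,$$ $$W(a,d)=-\frac\pi2I_0\sum_{n=1}^N\gamma_n^2-\frac\pi2\sum_{n=1}^N\sum_{k\ne n}\gamma_k\gamma_nI(|a_k-a_n|).$$ *)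

(* Defs.v *)
From HB Require Import structures.
From mathcomp Require Export all_boot all_order all_algebra.
From mathcomp Require Export all_classical all_reals all_analysis.
Export Order.TTheory GRing.Theory Num.Theory.
Export numFieldNormedType.Exports.

Set Implicit Arguments.
Unset Strict Implicit.
Unset Printing Implicit Defensive.

Local Open Scope classical_set_scope.
Local Open Scope ring_scope.

(* Vectors of R^N are row vectors indexed by 'I_N = {0, ..., N-1}: the
   mathematical n-th coordinate is the one of index n-1. *)
Definition fst_idx N (hN : (1 < N)%N) : 'I_N := Ordinal (ltnW hN).
Definition lst_idx N (hN : (1 < N)%N) : 'I_N := rev_ord (fst_idx hN).

Lemma lst_idxE N (hN : (1 < N)%N) : lst_idx hN = N.-1 :> nat.
Proof. by rewrite /= subn1. Qed.

Section Definitions.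
Variable R : realType.

Definition alt_plus N : 'rV[R]_N := \row_(n < N) (-1) ^+ n.
Definition alt_minus N : 'rV[R]_N := \row_(n < N) (-1) ^+ n.+1.

Definition theta (N : nat) : R :=
  if (N <= 2)%N then 0
  else if odd N then acos ((Num.sqrt N.+1%:R - 1) / N%:R)
  else acos ((Num.sqrt N%:R - 1) / N.-1%:R).

(* The truncated subtraction is harmless: N - 2 is only used when N is odd,
   and N >= 2 in all uses. *)
Definition Theta (N : nat) (d1 : R) : set R :=
  if ~~ odd N then `]theta N, pi - theta N[%classic
  else if d1 == 1 then `]theta (N - 2), pi - theta N[%classic
  else `]theta N, pi - theta (N - 2)[%classic.

Definition AN (N : nat) : set 'rV[R]_N :=
  [set a | forall i j : 'I_N, (i < j)%N -> a 0 i < a 0 j].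
Arguments AN : clear implicits.

(* Both integrands are Lebesgue integrable on ]0, +oo[ (for t > 0), so that the
   real-valued integral Rintegral takes no default value here. *)
Definition Iint (t : R) : R :=
  \int[lebesgue_measure]_(s in `]0, +oo[) (s * expR (- s) / (s ^+ 2 + t ^+ 2)).

Definition I0 : R :=
  \int[lebesgue_measure]_(s in `]0, +oo[) (expR (- s) * ln s).

Definition gamma N (alpha : R) (d : 'rV[R]_N) (n : 'I_N) : R :=
  d 0 n - cos alpha.

Definition W N (alpha : R) (d a : 'rV[R]_N) : R :=
  - (pi / 2) * I0 * (\sum_(n < N) gamma alpha d n ^+ 2)
  - pi / 2 * \sum_(n < N) \sum_(k < N | k != n)
      gamma alpha d k * gamma alpha d n * Iint `|a 0 k - a 0 n|.

Definition inf_AN N (F : 'rV[R]_N -> R) : \bar R :=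
  ereal_inf [set (F a)%:E | a in AN N].

Definition critical_point N (F : 'rV[R]_N -> R) (a : 'rV[R]_N) : Prop :=
  AN N a /\ is_diff a F (cst 0).

Definition minimiser N (F : 'rV[R]_N -> R) (a : 'rV[R]_N) : Prop :=
  AN N a /\ forall b, AN N b -> F a <= F b.

End Definitions.

Arguments AN {R} N _.

(* Main.v *)
Require Import Defs.
From mathcomp Require Import measurable_realfun zify ring lra.
Local Open Scope classical_set_scope.
Local Open Scope ring_scope.

(** Write [c = cos alpha]. The substitution [s = t x] turns [I(t)] into the Laplace
    transform at [t] of the density [x / (1 + x^2)] (lemma [Iint_laplace]), so that
    [-I'(t)] is the Laplace transform of [x^2 / (1 + x^2)]. Everything about the kernel
    follows by comparing densities: [I] is nonnegative, decreasing and unbounded at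
    [0]; its slope is strictly monotone; and multiplying a distance by a bounded factor
    changes [I] by a bounded amount.

    Bounds on the energy. Up to a constant, [W] is [- pi] times the sum of
    [gamma_k gamma_n I(a_n - a_k)] over the pairs [k < n]. Because of the logarithmic
    singularity only the total coupling, or strength, of groups of consecutive
    particles matters. If no such group has positive strength, then cutting a
    configuration repeatedly at its largest gap shows that the sum is bounded above
    ([cluster_bound]). If some group has positive strength, then contracting it to a
    point makes the sum tend to infinity ([collapse_ge]). For alternating signs the
    strength is explicit ([strengthE]); the decisive groups are those of odd size [m]
    whose ends have the larger charge, and their strength is positive exactly when
    [m c^2 + 2 |c| > 1]. The angles that delimit [Theta] are those where equality
    holds for the largest available [m], or [0] if that [m] is [1].

    Critical points. [W] is differentiable, and a critical point is a configuration
    in which the force on every particle vanishes ([critical_pointP]). If the sign of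
    an end particle times [c] is nonnegative, the forces of the other particles on it
    form an alternating sum that is dominated by the repulsion of its neighbour
    ([first_force], [last_force]). So there is no equilibrium, and pushing that
    particle outwards always lowers the energy. For even [N] the two ends have
    opposite signs, so that one of them qualifies.

    Three particles. Put [e = d_1 c], [u = 1 - e] and [v = 1 + e]. By strict
    monotonicity of the slope the two gaps of an equilibrium have the same length
    [t], which solves [- v I'(t) + u I'(2t) = 0]. The left-hand side is the Laplace
    transform of a density that has constant sign unless [2 v < u < 8 v], that is,
    [-7/9 < e < -1/3], in which case it changes sign exactly once. In the first case
    there is no solution. In the second case there is at most one
    ([balance_uniq]), and one exists since the transform is negative near [0] and
    positive near infinity ([balance_root]). Since [e < -1/3], the group of all three
    particles has positive strength, so that [W] is unbounded below and the critical
    point is no minimiser. *)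

Set Implicit Arguments.
Unset Strict Implicit.
Unset Printing Implicit Defensive.

(** * Laplace transforms of bounded continuous densities *)

Section Laplace.
Context {R : realType}.
Notation mu := (@lebesgue_measure R).
Implicit Types (f g : R -> R) (t s x : R).

(** Continuity makes these functions measurable, boundedness on the half line makes
    their Laplace integrals converge at every [t > 0]. *)
Definition tame f := continuous f /\ exists M, forall x, 0 < x -> `|f x| <= M.

Definition laplace f t : R :=
  \int[mu]_(x in `]0, +oo[) (f x * expR (- (t * x))).

Lemma continuous_expRM t : continuous (fun x => expR (- (t * x))).
Proof.
move=> x; apply: (@continuous_comp _ _ _ (fun x => - (t * x)) expR); last exact: continuous_expR.
by apply: continuousN; apply: continuousM; [exact: cst_continuous|].
Qed.

(** The integrand is, up to the factor [t], the density of the exponential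
    distribution of rate [t]. *)
Lemma integral_expR t : 0 < t ->
  mu.-integrable `]0, +oo[ (EFin \o (fun x => expR (- (t * x)))) /\
  \int[mu]_(x in `]0, +oo[) expR (- (t * x)) = t^-1.
Proof.
move=> t0.
have sub : (`]0, +oo[ : set R) `<=` (`[0%R, +oo[ : set R).
  by move=> x /=; rewrite !in_itv /= !andbT => /ltW.
have E x : expR (- (t * x)) = t^-1 * (t * expR (- t * x)).
  by rewrite mulKf ?gt_eqF// mulNr.
have ipdf : mu.-integrable `[0%R, +oo[ (EFin \o (fun x => t * expR (- t * x))).
  have := integrable_exponential_pdf t0.
  rewrite (_ : EFin \o _ = ((EFin \o (fun x => t * expR (- t * x))) \_ `[0%R, +oo[)).
    by move=> h; apply/integrable_mkcond.
  apply/funext => x; rewrite /exponential_pdf /= !patchE.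
  by case: ifP.
have int0 : mu.-integrable `[0%R, +oo[ (EFin \o (fun x => expR (- (t * x)))).
  rewrite (_ : EFin \o _ = (fun x => (t^-1)%:E * (t * expR (- t * x))%:E)%E).
    exact: integrableZl.
  by apply/funext => x /=; rewrite E EFinM.
have int1 : mu.-integrable `]0, +oo[ (EFin \o (fun x => expR (- (t * x)))).
  exact: integrableS int0.
split => //.
rewrite Rintegral_itv_obnd_cbnd//.
under eq_Rintegral do rewrite E.
rewrite RintegralZl// Rintegral_mkcond.
have := integral_exponential_pdf t0; rewrite /Rintegral.
rewrite /exponential_pdf => ->.
by rewrite mulr1.
Qed.

Lemma tame_integrable f t : 0 < t -> tame f ->
  mu.-integrable `]0, +oo[ (EFin \o (fun x => f x * expR (- (t * x)))).
Proof.
move=> t0 [cf [M fM]].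
apply: (@le_integrable _ _ _ mu `]0, +oo[ _ _ (EFin \o (fun x => M * expR (- (t * x))))) => //.
- apply/measurable_EFinP; apply: measurable_funTS; apply: continuous_measurable_fun.
  by move=> x; apply: cvgM; [exact: cf | exact: continuous_expRM].
- move=> x /=; rewrite in_itv/= andbT => x0.
  rewrite lee_fin !normrM (ger0_norm (expR_ge0 _)) ler_pM2r ?expR_gt0//.
  by apply: le_trans (fM _ x0) _; exact: ler_norm.
- rewrite (_ : _ \o _ = (fun x => M%:E * (expR (- (t * x)))%:E)%E).
    by apply: integrableZl => //; exact: (integral_expR t0).1.
  by apply/funext => x /=; rewrite EFinM.
Qed.

Lemma tameD f g : tame f -> tame g -> tame (fun x => f x + g x).
Proof.
move=> [cf [M fM]] [cg [N gN]]; split.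
  by move=> x; apply: cvgD; [exact: cf|exact: cg].
exists (M + N) => x x0; apply: le_trans (ler_normD _ _) _.
by apply: lerD; [exact: fM|exact: gN].
Qed.

Lemma tameM f g : tame f -> tame g -> tame (fun x => f x * g x).
Proof.
move=> [cf [M fM]] [cg [N gN]]; split.
  by move=> x; apply: cvgM; [exact: cf|exact: cg].
exists (M * N) => x x0; rewrite normrM.
by apply: ler_pM => //; [exact: fM|exact: gN].
Qed.

Lemma tame_cst (k : R) : tame (fun=> k).
Proof. by split; [exact: cst_continuous|exists `|k|]. Qed.

Lemma tameZ k f : tame f -> tame (fun x => k * f x).
Proof. by move=> ?; apply: tameM => //; exact: tame_cst. Qed.

Lemma tame_expR t : 0 <= t -> tame (fun x => expR (- (t * x))).
Proof.
move=> t0; split; first exact: continuous_expRM.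
exists 1 => x x0; rewrite ger0_norm ?expR_ge0// -expR0 ler_expR oppr_le0.
by rewrite mulr_ge0// ltW.
Qed.

Lemma laplaceD f g t : 0 < t -> tame f -> tame g ->
  laplace (fun x => f x + g x) t = laplace f t + laplace g t.
Proof.
move=> t0 tf tg; rewrite /laplace -RintegralD//; try exact: tame_integrable.
by apply: eq_Rintegral => x _; rewrite mulrDl.
Qed.

Lemma laplaceZ k f t : 0 < t -> tame f ->
  laplace (fun x => k * f x) t = k * laplace f t.
Proof.
move=> t0 tf; rewrite /laplace -RintegralZl//; last exact: tame_integrable.
by apply: eq_Rintegral => x _; rewrite mulrA.
Qed.

Lemma laplace_shift f t s : laplace (fun x => f x * expR (- (s * x))) t = laplace f (s + t).
Proof.
apply: eq_Rintegral => x _; rewrite -mulrA -expRD; congr (_ * expR _); ring.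
Qed.

Lemma laplace_cst k t : 0 < t -> laplace (fun=> k) t = k / t.
Proof.
move=> t0; rewrite /laplace RintegralZl// ?(integral_expR t0).2//.
exact: (integral_expR t0).1.
Qed.

Lemma laplace_expR s t : 0 <= s -> 0 < t ->
  laplace (fun x => expR (- (s * x))) t = (s + t)^-1.
Proof.
move=> s0 t0; have st0 : 0 < s + t by exact: ltr_wpDl.
rewrite -[RHS]mul1r -(laplace_cst 1 st0) -laplace_shift.
by apply: eq_Rintegral => x _; rewrite mul1r.
Qed.

Lemma eq_laplace f g t : (forall x, 0 < x -> f x = g x) -> laplace f t = laplace g t.
Proof.
by move=> fg; apply: eq_Rintegral => x; rewrite inE/= in_itv/= andbT => /fg ->.
Qed.

Lemma le_laplace f g t : 0 < t -> tame f -> tame g ->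
  (forall x, 0 < x -> f x <= g x) -> laplace f t <= laplace g t.
Proof.
move=> t0 tf tg fg; apply: le_Rintegral => //; try exact: tame_integrable.
by move=> x; rewrite /= in_itv/= andbT => /fg; rewrite ler_pM2r// expR_gt0.
Qed.

(** A nonnegative integrand with zero integral vanishes almost everywhere, which
    is impossible as soon as it is positive on an interval. *)
Lemma laplace_gt0 f t b : 0 < t -> tame f -> 0 < b ->
  (forall x, 0 < x -> 0 <= f x) -> (forall x, 0 < x < b -> 0 < f x) ->
  0 < laplace f t.
Proof.
move=> t0 tf b0 f0 fb.
have intf := tame_integrable t0 tf.
have ge0 : 0 <= laplace f t.
  apply: Rintegral_ge0 => x /=; rewrite in_itv/= andbT => x0.
  by rewrite mulr_ge0 ?f0 ?expR_ge0.
rewrite lt_def ge0 andbT; apply/eqP => L0.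
have I0 : (\int[mu]_(x in `]0%R, +oo[) `|(f x * expR (- (t * x)))%:E| = 0)%E.
  have := congr1 EFin L0; rewrite /laplace /Rintegral fineK; last exact: integrable_fin_num.
  move=> H; transitivity (0%:E : \bar R) => //; rewrite -H.
  apply: eq_integral => x; rewrite inE/= in_itv/= andbT => x0.
  by rewrite ger0_norm// mulr_ge0 ?f0 ?expR_ge0.
have mD : measurable (`]0, +oo[ : set R) by [].
have [N [mN N0 subN]] := (ae_eq_integral_abs mu mD (measurable_int mu intf)).1 I0.
have : (mu `]0%R, b[ <= mu N)%E.
  apply: le_measure; rewrite ?inE// => x /= ; rewrite in_itv/= => xb.
  apply: subN => /= h; have := h; rewrite in_itv/= andbT => /(_ (proj1 (andP xb))).
  by case=> /eqP; rewrite gt_eqF// mulr_gt0 ?expR_gt0// fb.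
rewrite N0 lebesgue_measure_itv/= lte_fin b0 sube0 lee_fin leNgt b0; exact/negP.
Qed.

(** Differentiation under the integral sign: for [s > t / 2] the derivative of
    the integrand is at most a multiple of [x * expR (- (t / 2 * x))], hence of
    [expR (- (t / 4 * x))]. *)
Lemma is_derive_laplace f t : 0 < t -> tame f ->
  is_derive t 1 (laplace f) (- laplace (fun x => x * f x) t).
Proof.
move=> t0 tf; have [cf [M fM]] := tf.
pose F s x := f x * expR (- (s * x)).
have dF s x : is_derive s 1 (F^~ x) (f x * (- x * expR (- (s * x)))).
  rewrite /F; apply: is_deriveZ.
  have h : is_derive s 1 (fun s => - (s * x)) (- x).
    have -> : (fun s => - (s * x)) = (fun s => - x * s).
      by apply/funext => r; rewrite mulNr mulrC.
    by apply: is_derive_eq; rewrite ?scaler1 ?mulr1.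
  rewrite mulrC.
  exact: (@is_derive1_comp _ expR (fun s => - (s * x))).
have D1 s x : partial1of2 F s x = f x * (- x * expR (- (s * x))).
  by rewrite partial1of2E; have [_ ->] := dF s x.
pose V : set R := `]t / 2, t + 1[%classic; pose D : set R := `]0, +oo[%classic.
have tt : V t by rewrite /V /= in_itv/=; lra.
pose G x := `|M| * ((4 / t) * expR (- ((t / 4) * x))).
have intF s : V s -> mu.-integrable `]0, +oo[ (EFin \o F s).
  rewrite /V /= in_itv/= => st; apply: tame_integrable => //; lra.
have dF1 s x : V s -> D x -> derivable (F ^~ x) s 1.
  by move=> _ _; have [] := dF s x.
have G0 x : 0 <= G x by rewrite /G !mulr_ge0 ?expR_ge0 ?invr_ge0// ltW.
have t40 : 0 < t / 4 by lra.
have intG : mu.-integrable `]0, +oo[ (EFin \o G).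
  rewrite (_ : _ \o _ = EFin \o (fun x => (`|M| * (4 / t)) * expR (- (t / 4 * x)))).
    by apply: tame_integrable => //; exact: tame_cst.
  by apply/funext => x; rewrite /= /G mulrA.
have Gub s x : V s -> D x -> `|partial1of2 F s x| <= G x.
  rewrite /V /D /= !in_itv/= andbT => /andP[st _] x0.
  rewrite D1 !normrM normrN (ger0_norm (expR_ge0 _)) (gtr0_norm x0) /G.
  apply: ler_pM => //; first by rewrite mulr_ge0 ?expR_ge0// ltW.
    by apply: le_trans (fM _ x0) _; exact: ler_norm.
  have h1 : x * (t / 4) <= expR (t / 4 * x).
    by have := expR_ge1Dx (t / 4 * x); lra.
  have h2 : expR (- (s * x)) <= expR (- (t / 4 * x)) * expR (- (t / 4 * x)).
    rewrite -expRD ler_expR -opprD lerN2 -mulrDl ler_pM2r//; lra.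
  apply: le_trans (_ : x * (expR (- (t / 4 * x)) * expR (- (t / 4 * x))) <= _).
    by rewrite ler_pM2l.
  rewrite mulrA ler_pM2r ?expR_gt0// expRN ler_pdivrMr ?expR_gt0//.
  by rewrite -ler_pdivrMl ?divr_gt0// invf_div [leLHS]mulrC.
have dL := @derivable_under_integral R _ _ mu F `]0, +oo[%classic
  (measurable_itv _) t (t / 2) (t + 1) tt intF dF1 G G0 intG Gub.
apply: DeriveDef => //.
rewrite -derive1E (@differentiation_under_integral R _ _ mu F `]0, +oo[%classic
  (measurable_itv _) t (t / 2) (t + 1) tt intF dF1 G G0 intG Gub).
have Jg : mu.-integrable D (EFin \o (fun x => x * f x * expR (- (t * x)))).
  apply: (le_integrable _ _ _ intG) => //.
    apply/measurable_EFinP; apply: measurable_funTS; apply: continuous_measurable_fun.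
    move=> x; apply: cvgM; last exact: continuous_expRM.
    by apply: cvgM; [exact: cvg_id|exact: cf].
  move=> x Dx; rewrite lee_fin /= (ger0_norm (G0 x)).
  apply: le_trans (Gub _ _ tt Dx); rewrite D1 le_eqVlt; apply/orP; left.
  by rewrite !mulNr mulrN normrN mulrCA mulrA.
rewrite /laplace -[RHS]mulN1r -RintegralZl//.
by apply: eq_Rintegral => x _; rewrite D1; ring.
Qed.

(** The substitution [x := t * y] on the half line. *)
Lemma Rintegral_scale (G : R -> R) t : 0 < t -> continuous G ->
  (forall x, 0 < x -> 0 <= G x) ->
  \int[mu]_(x in `]0, +oo[) G x = \int[mu]_(x in `]0, +oo[) (G (t * x) * t).
Proof.
move=> t0 cG G0; rewrite /Rintegral; congr fine.
pose F x := t * x.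
have dF x : is_derive x 1 F t.
  by rewrite /F; apply: is_derive_eq; rewrite ?scaler1 ?mulr1.
have F'E : derive1 F = cst t.
  by apply/funext => x; rewrite derive1E; have [_ ->] := dF x.
have F0 : F 0 = 0 by rewrite /F mulr0.
transitivity (\int[mu]_(x in `[F 0%R, +oo[) (G x)%:E)%E.
  rewrite F0 integral_itv_obnd_cbnd//.
  apply/measurable_EFinP; apply: measurable_funTS; exact: continuous_measurable_fun.
rewrite (@increasing_ge0_integration_by_substitutiony _ F G 0); first last.
- by move=> x; rewrite F0 in_itv/= andbT; exact: G0.
- by apply: continuous_subspaceT.
- by apply: gt0_cvgMry => //; exact: cvg_id.
- split; first by move=> x _; have [] := dF x.
  by apply: cvg_at_right_filter; apply: cvgM; [exact: cvg_cst|exact: cvg_id].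
- rewrite F'E; exact: is_cvg_cst.
- rewrite F'E; exact: is_cvg_cst.
- by move=> x _; rewrite F'E; exact: cst_continuous.
- by move=> x y _ _ xy; rewrite /F ltr_pM2l.
rewrite F'E -integral_itv_obnd_cbnd//.
apply/measurable_EFinP; apply: measurable_funTS.
apply: continuous_measurable_fun => x; apply: cvgM; last exact: cvg_cst.
apply: (@continuous_comp _ _ _ F G); last exact: cG.
by apply: cvgM; [exact: cvg_cst|exact: cvg_id].
Qed.

Lemma laplace_scale f k t : 0 < k -> tame f -> (forall x, 0 < x -> 0 <= f x) ->
  laplace f (k * t) = laplace (fun x => k^-1 * f (k^-1 * x)) t.
Proof.
move=> k0 [cf _] f0; rewrite /laplace (@Rintegral_scale _ k^-1) ?invr_gt0//; first last.
- by move=> x x0; rewrite mulr_ge0 ?expR_ge0 ?f0.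
- by move=> x; apply: cvgM; [exact: cf|exact: continuous_expRM].
apply: eq_Rintegral => x _; have -> : k * t * (k^-1 * x) = t * x.
  by field; rewrite gt_eqF.
by rewrite [LHS]mulrC mulrA.
Qed.

Definition pot_density x : R := x / (1 + x ^+ 2).

(** The substitution [s := t * x] moves the dependence on [t] into an exponential;
    everything that is needed about the kernel is read off this density. *)
Lemma Iint_laplace t : 0 < t -> Iint t = laplace pot_density t.
Proof.
move=> t0; have t2 s : s ^+ 2 + t ^+ 2 != 0 by rewrite gt_eqF// ltr_wpDl ?sqr_ge0// exprn_gt0.
have x2 s : 1 + s ^+ 2 != 0 by rewrite gt_eqF// ltr_pwDl ?sqr_ge0.
rewrite /Iint (Rintegral_scale t0); first last.
- by move=> x x0; rewrite divr_ge0 ?addr_ge0 ?sqr_ge0// mulr_ge0 ?expR_ge0// ltW.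
- move=> x; apply: cvgM; last first.
    apply: cvgV; first exact: t2.
    by apply: cvgD; [exact: exprn_continuous|exact: cvg_cst].
  apply: cvgM; first exact: cvg_id.
  by apply: (@continuous_comp _ _ _ -%R expR); [exact: opp_continuous|exact: continuous_expR].
apply: eq_Rintegral => x _; rewrite /pot_density; field.
by rewrite x2 t2.
Qed.

End Laplace.

(** * The interaction kernel *)

Section Kernel.
Context {R : realType}.
Implicit Types (f g : R -> R) (t s x u w : R).

Definition slope_density x : R := x ^+ 2 / (1 + x ^+ 2).

(** This is minus the derivative of [Iint] at [t > 0]. *)
Definition Islope t : R := laplace slope_density t.

(** Minus the derivative of the even function [Iint], at any nonzero point. *)
Definition force t : R := Num.sg t * Islope `|t|.

Lemma oneDsqr_gt0 x : 0 < 1 + x ^+ 2.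
Proof. by rewrite ltr_pwDl ?sqr_ge0. Qed.

Lemma continuous_oneDsqrV : continuous (fun x : R => (1 + x ^+ 2)^-1).
Proof.
move=> x; apply: cvgV; first by rewrite gt_eqF ?oneDsqr_gt0.
by apply: cvgD; [exact: cvg_cst|exact: exprn_continuous].
Qed.

Lemma tame_pot_density : tame (@pot_density R).
Proof.
split=> [x|]; first by apply: cvgM; [exact: cvg_id|exact: continuous_oneDsqrV].
exists 1 => x x0; rewrite ger0_norm; last by rewrite divr_ge0 ?ltW ?oneDsqr_gt0.
rewrite ler_pdivrMr ?oneDsqr_gt0//; nra.
Qed.

Lemma tame_slope_density : tame slope_density.
Proof.
split=> [x|]; first by apply: cvgM; [exact: exprn_continuous|exact: continuous_oneDsqrV].
exists 1 => x x0; rewrite ger0_norm; last by rewrite divr_ge0 ?sqr_ge0 ?ltW ?oneDsqr_gt0.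
rewrite ler_pdivrMr ?oneDsqr_gt0//; nra.
Qed.

Lemma mul_pot_density x : x * pot_density x = slope_density x.
Proof. by rewrite /pot_density /slope_density mulrA expr2. Qed.

Lemma pot_density_gt0 x : 0 < x -> 0 < pot_density x.
Proof. by move=> x0; rewrite divr_gt0 ?oneDsqr_gt0. Qed.

Lemma slope_density_gt0 x : 0 < x -> 0 < slope_density x.
Proof. by move=> x0; rewrite divr_gt0 ?oneDsqr_gt0 ?exprn_gt0. Qed.

Lemma slope_density_le1 x : slope_density x <= 1.
Proof. rewrite ler_pdivrMr ?oneDsqr_gt0//; nra. Qed.

Lemma laplace_pos f t : 0 < t -> tame f -> (forall x, 0 < x -> 0 < f x) -> 0 < laplace f t.
Proof.
move=> t0 tf f0; apply: (@laplace_gt0 _ _ _ 1) => // x; first by move/f0/ltW.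
by case/andP => /f0.
Qed.

Lemma laplaceB f g t : 0 < t -> tame f -> tame g ->
  laplace (fun x => f x - g x) t = laplace f t - laplace g t.
Proof.
move=> t0 tf tg; rewrite -mulN1r -laplaceZ// -laplaceD//; last exact: tameZ.
by apply: eq_laplace => x _; rewrite mulN1r.
Qed.

Lemma Islope_gt0 t : 0 < t -> 0 < Islope t.
Proof. by move=> t0; apply: laplace_pos => //; [exact: tame_slope_density|exact: slope_density_gt0]. Qed.

(** Differences of values of a transform are transforms again, so that monotonicity
    in [t] is a question of sign of a density. *)
Lemma laplace_sub f t s : 0 < t -> t <= s -> tame f ->
  laplace f t - laplace f s = laplace (fun x => f x * (1 - expR (- ((s - t) * x)))) t.
Proof.
move=> t0 ts tf; have st : 0 <= s - t by rewrite subr_ge0.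
rewrite -[s in LHS](subrK t) -laplace_shift -laplaceB//; last first.
  by apply: tameM => //; exact: tame_expR.
by apply: eq_laplace => x _; rewrite mulrBr mulr1.
Qed.

Lemma tame_sub f d : 0 <= d -> tame f -> tame (fun x => f x * (1 - expR (- (d * x)))).
Proof.
move=> d0 tf; apply: tameM => //.
rewrite (_ : (fun _ => _) = (fun x => 1 + -1 * expR (- (d * x)))); last first.
  by apply/funext => x; rewrite mulN1r.
by apply: tameD; [exact: tame_cst|apply: tameZ; exact: tame_expR].
Qed.

Lemma Islope_decr t s : 0 < t -> t < s -> Islope s < Islope t.
Proof.
move=> t0 ts; rewrite -subr_gt0 /Islope laplace_sub ?(ltW ts)//; last exact: tame_slope_density.
have st : 0 < s - t by rewrite subr_gt0.
apply: laplace_pos => //; first by apply: tame_sub; [exact: ltW|exact: tame_slope_density].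
move=> x x0; rewrite mulr_gt0 ?slope_density_gt0// subr_gt0 -expR0 ltr_expR oppr_lt0.
by rewrite mulr_gt0.
Qed.

Lemma Islope_inj t s : 0 < t -> 0 < s -> Islope t = Islope s -> t = s.
Proof.
move=> t0 s0 E; have [ts|st|//] := ltgtP t s.
  by have := Islope_decr t0 ts; rewrite E ltxx.
by have := Islope_decr s0 st; rewrite E ltxx.
Qed.

Lemma Iint_norm t : Iint `|t| = Iint t.
Proof. by rewrite /Iint; apply: eq_Rintegral => x _; rewrite real_normK// num_real. Qed.

Lemma Iint_opp t : Iint (- t) = Iint t.
Proof. by rewrite -Iint_norm normrN Iint_norm. Qed.

Lemma is_derive_Iint t : t != 0 -> is_derive t 1 (@Iint R) (- force t).
Proof.
have posd s : 0 < s -> is_derive s 1 (@Iint R) (- Islope s).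
  move=> s0; apply: (@near_eq_is_derive _ _ _ (laplace (@pot_density R))).
  - near=> x; rewrite Iint_laplace//; near: x.
    exact: lt_nbhsr.
  - have -> : Islope s = laplace (fun x => x * pot_density x) s.
      by apply: eq_laplace => x _; rewrite mul_pot_density.
    by apply: is_derive_laplace => //; exact: tame_pot_density.
rewrite neq_lt => /orP[t0|t0]; rewrite /force; last first.
  by rewrite gtr0_sg// mul1r gtr0_norm//; exact: posd.
rewrite ltr0_sg// mulN1r opprK ltr0_norm//.
have -> : @Iint R = @Iint R \o -%R by apply/funext => x; rewrite /= Iint_opp.
rewrite -[Islope _]opprK -mulrN1.
have nt0 : 0 < - t by rewrite oppr_gt0.
exact: (is_derive1_comp (posd _ nt0)).
Unshelve. all: by end_near. Qed.

Lemma Iint_ge0 t : 0 < t -> 0 <= Iint t.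
Proof.
move=> t0; rewrite Iint_laplace//; apply/ltW/laplace_pos => //; [exact: tame_pot_density|exact: pot_density_gt0].
Qed.

Lemma Iint_nincr u w : 0 < u -> u <= w -> Iint w <= Iint u.
Proof.
move=> u0 uw; have w0 := lt_le_trans u0 uw.
rewrite !Iint_laplace// -subr_ge0 laplace_sub//; last exact: tame_pot_density.
have d0 : 0 <= w - u by rewrite subr_ge0.
have -> : 0 = laplace (fun=> 0) u by rewrite laplace_cst// mul0r.
apply: le_laplace => //; [exact: tame_cst|by apply: tame_sub => //; exact: tame_pot_density|].
move=> x x0; rewrite mulr_ge0 ?(ltW (pot_density_gt0 _))// subr_ge0 -expR0 ler_expR oppr_le0.
by rewrite mulr_ge0 ?(ltW x0).
Qed.

(** The logarithmic singularity of the kernel: multiplying a distance by a bounded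
    factor changes the kernel by a bounded amount. This follows from
    [1 - expR (- y) <= y] and [slope_density <= 1]. *)
Lemma Iint_drop_le u w : 0 < u -> u <= w -> Iint u - Iint w <= (w - u) / u.
Proof.
move=> u0 uw; have w0 := lt_le_trans u0 uw.
rewrite !Iint_laplace// laplace_sub//; last exact: tame_pot_density.
have d0 : 0 <= w - u by rewrite subr_ge0.
rewrite -laplace_cst//; apply: le_laplace => //.
- by apply: tame_sub => //; exact: tame_pot_density.
- exact: tame_cst.
move=> x x0; apply: le_trans (_ : pot_density x * ((w - u) * x) <= _).
  rewrite ler_pM2l ?pot_density_gt0//.
  by have := expR_ge1Dx (- ((w - u) * x)); lra.
by rewrite mulrCA [pot_density x * x]mulrC mul_pot_density ler_piMr// slope_density_le1.
Qed.

(** Combinations of exponentials serve as explicit minorants and majorants of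
    rational densities, since their transforms are rational. *)
Definition exp_poly (a b c d : R) x : R :=
  a + (b * expR (- (1 * x)) + (c * expR (- (2 * x)) + d * expR (- (3 * x)))).

Lemma tame_exp_poly a b c d : tame (exp_poly a b c d).
Proof.
by apply: tameD; [exact: tame_cst|apply: tameD; [|apply: tameD]; apply: tameZ; exact: tame_expR].
Qed.

Lemma laplace_exp_poly a b c d t : 0 < t ->
  laplace (exp_poly a b c d) t = a / t + (b / (1 + t) + (c / (2 + t) + d / (3 + t))).
Proof.
move=> t0; have te k k' : 0 <= k' -> tame (fun x => k * expR (- (k' * x))).
  by move=> ?; apply: tameZ; exact: tame_expR.
rewrite /exp_poly !laplaceD ?laplaceZ ?laplace_cst ?laplace_expR//;
  by do ?[exact: te|exact: tame_cst|exact: tame_expR|apply: tameD].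
Qed.

Lemma exp_polyE p q x : exp_poly (p - q) (3 * q - 2 * p) (p - 3 * q) q x =
  p * (1 - expR (- x)) ^+ 2 - q * (1 - expR (- x)) ^+ 3.
Proof.
rewrite /exp_poly mul1r; have -> : - (3 * x) = - x + (- x + - x) by ring.
have -> : - (2 * x) = - x + - x by ring.
by rewrite !expRD; ring.
Qed.

(** The density of the difference is at least
    [t * slope_density x * expR (- (t * x))], and
    [2 * slope_density x >= (1 - expR (- x)) ^+ 2]. *)
Lemma Iint_double t : 0 < t -> t <= 1 / 8 -> 1 / 8 <= Iint t - Iint (2 * t).
Proof.
move=> t0 t8; have t20 : 0 < 2 * t by rewrite mulr_gt0.
rewrite !Iint_laplace// laplace_sub//; [|lra|exact: tame_pot_density].
have -> : 2 * t - t = t by ring.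
pose y := exp_poly 1 (-2) 1 0.
have ty : tame y by exact: tame_exp_poly.
have yE x : y x = (1 - expR (- x)) ^+ 2.
  have := exp_polyE 1 0 x; rewrite mul1r mul0r !subr0 => <-.
  by rewrite /y; congr (exp_poly _ _ _ _ _); ring.
have tye : tame (fun x => y x * expR (- (t * x))).
  by apply: tameM => //; apply: tame_expR; exact: ltW.
apply: le_trans (_ : laplace (fun x => t / 2 * (y x * expR (- (t * x)))) t <= _).
  rewrite laplaceZ// laplace_shift laplace_exp_poly; last by rewrite addr_gt0.
  have h1 : (1 + (t + t))^-1 <= 1 by rewrite invf_le1; lra.
  have h2 : 0 <= (2 + (t + t))^-1 by rewrite invr_ge0; lra.
  have h3 : t / 2 * (1 / (t + t)) = 1 / 4 by field; rewrite gt_eqF//; lra.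
  nra.
apply: le_laplace => //; [exact: tameZ|by apply: tame_sub; [exact: ltW|exact: tame_pot_density]|].
move=> x x0.
have E0 := expR_gt0 (- (t * x)).
have h1 : t * x * expR (- (t * x)) <= 1 - expR (- (t * x)).
  have := expR_ge1Dx (t * x); rewrite -(ler_pM2r E0) -expRD subrr expR0; lra.
have h2 : y x <= 2 * slope_density x.
  rewrite yE; set z := expR (- x).
  have z0 : 0 < z by exact: expR_gt0.
  have z1 : z <= 1 by rewrite -expR0 ler_expR oppr_le0 ltW.
  have zx : 1 - x <= z by exact: expR_ge1Dx.
  rewrite /slope_density mulrA ler_pdivlMr ?oneDsqr_gt0//.
  have k1 : (1 - z) ^+ 2 <= x ^+ 2 by nra.
  have k2 : (1 - z) ^+ 2 <= 1 by nra.
  nra.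
apply: le_trans (_ : pot_density x * (t * x * expR (- (t * x))) <= _); last first.
  by rewrite ler_pM2l ?pot_density_gt0.
have -> : pot_density x * (t * x * expR (- (t * x))) = t / 2 * (2 * slope_density x * expR (- (t * x))).
  by rewrite -mul_pot_density; field.
by rewrite ler_pM2l ?divr_gt0// ler_pM2r.
Qed.

(** Each halving of the argument adds at least [1 / 8]. *)
Lemma Iint_unbounded M : exists2 t : R, 0 < t & M <= Iint t.
Proof.
pose T n : R := 1 / 8 / 2 ^+ n.
have T0 n : 0 < T n by rewrite /T !divr_gt0// exprn_gt0.
have T8 n : T n <= 1 / 8.
  by rewrite /T ler_piMr// invf_le1 ?exprn_gt0// exprn_ege1// ler1n.
have H n : n%:R / 8 <= Iint (T n).
  elim: n => [|n IH]; first by rewrite mul0r Iint_ge0.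
  have := Iint_double (T0 n.+1) (T8 n.+1).
  have -> : 2 * T n.+1 = T n by rewrite /T exprS; field; rewrite expf_neq0.
  by move=> D; rewrite -natr1; lra.
have Mn := archi_boundP (normr_ge0 (8 * M)); move: (Num.bound _) Mn => n Mn.
exists (T n) => //; apply: le_trans (H n).
have := ler_norm (8 * M); lra.
Qed.

End Kernel.

(** * The differential of the energy *)

Section Differential.
Context {R : realType}.
Implicit Types (alpha : R).

Lemma is_diff_sum (V W : normedModType R) (I : Type) (r : seq I) (P : pred I)
    (f df : I -> V -> W) (a : V) :
  (forall i, P i -> is_diff a (f i) (df i)) ->
  is_diff a (fun x => \sum_(i <- r | P i) f i x) (fun x => \sum_(i <- r | P i) df i x).
Proof.
move=> H; elim: r => [|i r IH].
  rewrite (_ : (fun=> _) = cst 0); last by apply/funext => x; rewrite big_nil.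
  rewrite [X in is_diff _ _ X](_ : _ = 0); first exact: is_diff_cst.
  by apply/funext => x; rewrite big_nil.
have [Pi|nPi] := boolP (P i); last first.
  under [X in is_diff _ X]eq_fun do rewrite big_cons (negbTE nPi).
  by under [X in is_diff _ _ X]eq_fun do rewrite big_cons (negbTE nPi).
under [X in is_diff _ X]eq_fun do rewrite big_cons Pi.
under [X in is_diff _ _ X]eq_fun do rewrite big_cons Pi.
by apply: is_diffD IH; exact: H.
Qed.

Lemma is_diff_coord m n (M : 'M[R]_(m, n)) i j :
  is_diff M (fun X : 'M[R]_(m, n) => X i j : R) (fun X => X i j).
Proof.
have @f : {linear 'M[R]_(m, n) -> R}.
  by exists (fun N : 'M[R]_(_, _) => N i j); do 2![eexists]; do ?[constructor];
     rewrite ?mxE// => ? *; rewrite ?mxE//; move=> ?; rewrite !mxE.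
apply: DiffDef; first exact: differentiable_coord.
by rewrite (@diff_lin _ _ _ f)//; exact: coord_continuous.
Qed.

Lemma is_diff_Iint (t : R) : t != 0 -> is_diff t (@Iint R) (fun h => h * - force t).
Proof.
move=> t0; have [dI DI] := is_derive_Iint t0.
apply: DiffDef; first exact/derivable1_diffP.
by rewrite deriv1E// derive1E DI.
Qed.

Lemma is_diff_pair_energy N (a : 'rV[R]_N) k n : a 0 k - a 0 n != 0 ->
  is_diff a (fun x => Iint (x 0 k - x 0 n))
    (fun v => (v 0 k - v 0 n) * - force (a 0 k - a 0 n)).
Proof.
move=> akn.
have h : is_diff a (fun x : 'rV[R]_N => x 0 k - x 0 n) (fun v => v 0 k - v 0 n).
  by apply: is_diffB; exact: is_diff_coord.
exact: (@is_diff_comp _ _ _ _ (fun x : 'rV[R]_N => x 0 k - x 0 n) _ (@Iint R)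
  _ _ h (is_diff_Iint akn)).
Qed.

Lemma force_opp (t : R) : force (- t) = - force t.
Proof. by rewrite /force sgrN normrN mulNr. Qed.

(** The force exerted on particle [m] by the others, up to its own charge
    [g m]. *)
Definition total_force N (g : 'I_N -> R) (a : 'rV[R]_N) m : R :=
  \sum_(k < N | k != m) g k * force (a 0 m - a 0 k).

(** The differential of [W] at [a], applied to the displacement [v]. *)
Definition dW N alpha (d a v : 'rV[R]_N) : R :=
  pi * \sum_(m < N) v 0 m * (gamma alpha d m * total_force (gamma alpha d) a m).

Lemma AN_neq N (a : 'rV[R]_N) i j : AN N a -> i != j -> a 0 i - a 0 j != 0.
Proof.
move=> aN; rewrite -(inj_eq val_inj) neq_ltn subr_eq0.
by case/orP => /aN h; rewrite ?(lt_eqF h) ?(gt_eqF h).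
Qed.

(** The ordered pairs [(k, n)] and [(n, k)] contribute equally because [force] is
    odd; this gathers the differential into one term for each particle. *)
Lemma is_diff_W N alpha (d a : 'rV[R]_N) : AN N a ->
  is_diff a (W alpha d) (dW alpha d a).
Proof.
move=> aN; set g := gamma alpha d.
pose c := - (pi / 2) * I0 R * (\sum_(n < N) g n ^+ 2).
pose E (x : 'rV[R]_N) := \sum_(n < N) \sum_(k < N | k != n) (g k * g n) *: Iint (x 0 k - x 0 n).
pose dE (v : 'rV[R]_N) := \sum_(n < N) \sum_(k < N | k != n)
   (g k * g n) *: ((v 0 k - v 0 n) * - force (a 0 k - a 0 n)).
have hE : is_diff a E dE.
  apply: is_diff_sum => n _; apply: is_diff_sum => k kn.
  by apply: is_diffZ; apply: is_diff_pair_energy; exact: AN_neq.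
have -> : W alpha d = cst c + (- (pi / 2)) *: E.
  apply/funext => x; rewrite /W -/g -/c.
  transitivity (c + - (pi / 2) * E x) => //; rewrite mulNr; congr (_ - _ * _).
  by apply: eq_bigr => n _; apply: eq_bigr => k _; rewrite Iint_norm.
have hW : is_diff a (cst c + (- (pi / 2)) *: E) (0 + (- (pi / 2)) *: dE).
  have h0 : is_diff a (cst c : 'rV[R]_N -> R) 0 := is_diff_cst c a.
  have h1 : is_diff a (- (pi / 2) *: E) (- (pi / 2) *: dE) by exact: is_diffZ.
  exact: (is_diffD h0 h1).
apply: is_diff_eq; apply/funext => v; rewrite add0r /dW -/g.
rewrite -[LHS]/(- (pi / 2) * dE v) /dE.
have -> : \sum_(n < N) \sum_(k < N | k != n) (g k * g n) *: ((v 0 k - v 0 n) * - force (a 0 k - a 0 n)) =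
   - 2 * \sum_(m < N) v 0 m * (g m * total_force g a m); last by field.
pose X n k := v 0 n * (g n * (g k * force (a 0 n - a 0 k))).
transitivity (- \sum_(n < N) \sum_(k < N | k != n) X n k - \sum_(n < N) \sum_(k < N | k != n) X k n).
  rewrite -!sumrN -big_split; apply: eq_bigr => n _.
  rewrite -!sumrN -big_split; apply: eq_bigr => k _ /=.
  rewrite /X -[a 0 n - a 0 k]opprB force_opp /GRing.scale /=; ring.
have -> : \sum_(n < N) \sum_(k < N | k != n) X k n = \sum_(n < N) \sum_(k < N | k != n) X n k.
  under eq_bigr do rewrite big_mkcond; rewrite exchange_big /=.
  by apply: eq_bigr => n _; rewrite [RHS]big_mkcond; apply: eq_bigr => k _; rewrite eq_sym.
under [in RHS]eq_bigr do rewrite /total_force !mulr_sumr.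
rewrite /X; ring.
Qed.

(** A critical point is an equilibrium: since no charge vanishes, testing the
    differential against the coordinate vectors gives one equation for each
    particle. *)
Lemma critical_pointP N alpha (d a : 'rV[R]_N) :
  (forall m, gamma alpha d m != 0) ->
  critical_point (W alpha d) a <->
  AN N a /\ forall m, total_force (gamma alpha d) a m = 0.
Proof.
move=> g0; split => [[aN Wa]|[aN F0]]; split=> //; last first.
  have h := is_diff_W alpha d aN.
  apply: is_diff_eq; apply/funext => v; rewrite /dW big1 ?mulr0// => m _.
  by rewrite F0 !mulr0.
have dW0 : dW alpha d a = cst 0.
  have [_ <-] := is_diff_W alpha d aN; by have [_ ->] := Wa.
move=> m; have := congr1 (fun F => F (delta_mx 0 m)) dW0.
rewrite /dW (bigD1 m)//= big1 => [|k km]; last first.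
  by rewrite mxE eqxx (negbTE km) mul0r.
rewrite mxE !eqxx mul1r addr0 => /eqP; rewrite !mulf_eq0 (negbTE (g0 m)) gt_eqF ?pi_gt0//=.
by move/eqP.
Qed.

End Differential.

(** * Forces on the two end particles *)

Section EndParticles.
Context {R : realType}.
Implicit Types (alpha s e : R).

(** Leibniz' criterion: the terms are grouped in pairs, and adding [e >= 0] to each
    sign only helps. *)
Lemma leibniz_gt0 e n (D : nat -> R) : 0 <= e -> (0 < n)%N ->
  (forall i, (i < n)%N -> 0 < D i) ->
  (forall i, (i.+1 < n)%N -> D i.+1 < D i) ->
  0 < \sum_(i < n) ((-1) ^+ i + e) * D i.
Proof.
move=> e0; elim/ltn_ind: n D => -[//|[|[|n]]] IH D _ D0 D1.
- by rewrite big_ord_recl big_ord0 addr0 expr0 mulr_gt0 ?D0// ltr_pwDl.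
- rewrite !big_ord_recl big_ord0 addr0 /= /bump /= expr0 expr1.
  by have := D1 0 isT; have := D0 0 isT; have := D0 1 isT; nra.
- rewrite 2!big_ord_recl /= /bump /= expr0 expr1.
  have h1 : 0 <= (1 + e) * D 0 + (-1 + e) * D 1.
    by have := D1 0 isT; have := D0 0 isT; have := D0 1 isT; nra.
  have h2 : 0 < \sum_(i < n.+1) ((-1) ^+ i + e) * D i.+2.
    by apply: (IH n.+1 _ (fun i => D i.+2)) => // i i_n; [exact: D0|exact: D1].
  rewrite addrA; apply: ltr_wpDl => //.
  rewrite (eq_bigr (fun i : 'I_n.+1 => ((-1) ^+ i + e) * D i.+2))// => i _.
  by rewrite !add1n !exprS !mulN1r opprK.
Qed.

Definition alternating_row s N : 'rV[R]_N := \row_(n < N) (s * (-1) ^+ n).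

Lemma sum_neq_ord0 n (F : 'I_n.+1 -> R) :
  \sum_(k < n.+1 | k != ord0) F k = \sum_(i < n) F (lift ord0 i).
Proof.
rewrite big_mkcond big_ord_recl eqxx /= add0r; exact: eq_bigr.
Qed.

Lemma sum_neq_ord_max n (F : 'I_n.+1 -> R) :
  \sum_(k < n.+1 | k != ord_max) F k = \sum_(i < n) F (widen_ord (leqnSn n) (rev_ord i)).
Proof.
rewrite big_mkcond big_ord_recr /= eqxx addr0.
rewrite (reindex_inj rev_ord_inj); apply: eq_bigr => i _.
by rewrite -(inj_eq val_inj) /= ltn_eqF// ltn_subrL (leq_ltn_trans _ (ltn_ord i)).
Qed.

Lemma force_gt0E (t : R) : 0 < t -> force t = Islope t.
Proof. by move=> t0; rewrite /force gtr0_sg// mul1r gtr0_norm. Qed.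

(** Relative to the sign of the first particle, its nearest neighbours have the
    charges [-(1 + e), 1 - e, -(1 + e), ...] with [e = s * cos alpha], and the forces
    decrease with the distance; for [e >= 0] the alternating sum has the sign of its
    first term, a repulsion. *)
Lemma first_force alpha s n (a : 'rV[R]_n.+2) : s * s = 1 -> 0 <= s * cos alpha ->
  AN _ a -> 0 < s * total_force (gamma alpha (alternating_row s n.+2)) a ord0.
Proof.
move=> ss e0 aN; rewrite /total_force sum_neq_ord0 mulr_sumr.
rewrite (eq_bigr (fun i : 'I_n.+1 =>
   ((-1) ^+ i + s * cos alpha) * Islope (a 0 (inord i.+1) - a 0 ord0))); last first.
  move=> i _; have -> : inord i.+1 = lift ord0 i.
    by apply: val_inj; rewrite /= inordK// ltnS.
  have ai : 0 < a 0 (lift ord0 i) - a 0 ord0 by rewrite subr_gt0 aN.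
  rewrite -[a 0 ord0 - _]opprB force_opp force_gt0E// /gamma mxE /= /bump /= add1n exprS.
  by move: (Islope _) ((-1) ^+ _) => j w; ring: ss.
have av i j : (i < j < n.+2)%N -> a 0 (inord i) < a 0 (inord j).
  by case/andP => ij jn; apply: aN; rewrite !inordK// (ltn_trans ij).
have -> : ord0 = inord 0 :> 'I_n.+2 by apply: val_inj; rewrite /= inordK.
apply: (@leibniz_gt0 _ _ (fun i => Islope (a 0 (inord i.+1) - a 0 (inord 0)))) => // i i_n.
  by apply: Islope_gt0; rewrite subr_gt0 av.
by apply: Islope_decr; rewrite ?subr_gt0 ?ltrD2r av//; lia.
Qed.

(** Mirror image of [first_force]. *)
Lemma last_force alpha s n (a : 'rV[R]_n.+2) (u := s * (-1) ^+ n.+1) :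
  s * s = 1 -> 0 <= u * cos alpha ->
  AN _ a -> u * total_force (gamma alpha (alternating_row s n.+2)) a ord_max < 0.
Proof.
move=> ss e0 aN; rewrite /total_force sum_neq_ord_max -oppr_gt0 -mulNr mulr_sumr.
rewrite (eq_bigr (fun i : 'I_n.+1 =>
   ((-1) ^+ i + u * cos alpha) * Islope (a 0 ord_max - a 0 (inord (n - i))))); last first.
  move=> i _; have -> : inord (n - i) = widen_ord (leqnSn n.+1) (rev_ord i).
    by apply: val_inj; rewrite /= inordK// ltnS (leq_trans (leq_subr _ _)).
  rewrite force_gt0E; last first.
    by rewrite subr_gt0 aN//= subSS ltnS leq_subr.
  rewrite /gamma mxE /= subSS.
  have -> : u = - (s * (-1) ^+ (n - i) * (-1) ^+ i).
    by rewrite /u -mulrA -exprD subnK ?exprS ?mulN1r ?mulrN// -ltnS.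
  have : (-1) ^+ (n - i) * (-1) ^+ (n - i) = 1 :> R by rewrite -expr2 sqrr_sign.
  move: (Islope _) ((-1) ^+ (n - i)) ((-1) ^+ i) => j w z ww.
  ring: ww ss.
have av i j : (i < j < n.+2)%N -> a 0 (inord i) < a 0 (inord j).
  by case/andP => ij jn; apply: aN; rewrite !inordK// (ltn_trans ij).
have -> : ord_max = inord n.+1 :> 'I_n.+2 by apply: val_inj; rewrite /= inordK.
apply: (@leibniz_gt0 _ _ (fun i => Islope (a 0 (inord n.+1) - a 0 (inord (n - i))))) => // i i_n.
  by apply: Islope_gt0; rewrite subr_gt0 av//; lia.
by apply: Islope_decr; rewrite ?subr_gt0 ?ltrD2l ?ltrN2 av//; lia.
Qed.

(** The mean value theorem on the segment from [a] to [a + v]. *)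
Lemma W_line_decr N alpha (d a v : 'rV[R]_N) :
  (forall h : R, 0 <= h -> AN N (a + h *: v)) ->
  (forall h : R, 0 <= h -> dW alpha d (a + h *: v) v < 0) ->
  W alpha d (a + v) < W alpha d a.
Proof.
move=> aN dneg; pose phi (h : R) := W alpha d (a + h *: v).
have dphi (h : R) : 0 <= h -> is_derive h 1 phi (dW alpha d (a + h *: v) v).
  move=> h0.
  have l : is_diff h (fun k : R => a + k *: v) (fun k => k *: v).
    have l1 : is_diff h (fun k : R => k *: v) (fun k => k *: v) := is_diff_scalel h v.
    have l2 : is_diff h (fun _ : R => a) 0 := is_diff_cst a h.
    rewrite -[X in is_diff _ _ X]add0r.
    exact: (is_diffD l2 l1).
  have [dc Dc] := @is_diff_comp _ _ _ _ (fun k : R => a + k *: v) _ (W alpha d)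
    _ h l (is_diff_W alpha d (aN _ h0)).
  apply: DeriveDef; first exact: diff_derivable.
  by rewrite deriveE// Dc /= scale1r.
have cphi : {within `[0, 1], continuous phi}.
  apply: derivable_within_continuous => x; rewrite in_itv/= => /andP[x0 _].
  by have [] := dphi _ x0.
have dphi01 (x : R) : x \in `]0, 1[%R -> is_derive x 1 phi (dW alpha d (a + x *: v) v).
  by rewrite in_itv/= => /andP[/ltW x0 _]; exact: dphi.
have [c] := @MVT R phi (fun h => dW alpha d (a + h *: v) v) 0 1 ltr01 dphi01 cphi.
rewrite in_itv/= subr0 mulr1 /phi scale1r scale0r addr0 => /andP[/ltW c0 _] E.
by rewrite -subr_lt0 E dneg.
Qed.

Lemma dW_delta N alpha (d a : 'rV[R]_N) m k :
  dW alpha d a (k *: delta_mx 0 m) = pi * (k * (gamma alpha d m * total_force (gamma alpha d) a m)).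
Proof.
rewrite /dW (bigD1 m)//= big1 => [|i im]; last first.
  by rewrite !mxE eqxx (negbTE im) mulr0 mul0r.
by rewrite !mxE !eqxx mulr1 addr0.
Qed.

Lemma AN_first n (a : 'rV[R]_n.+1) (h : R) : 0 <= h -> AN _ a ->
  AN _ (a + h *: (-1 *: delta_mx 0 ord0)).
Proof.
move=> h0 aN i j ij; rewrite !mxE !eqxx /=.
have -> : (j == ord0) = false by apply/eqP => j0; rewrite j0 in ij.
have := aN _ _ ij; case: (i == ord0) => /=; lra.
Qed.

Lemma AN_last n (a : 'rV[R]_n.+1) (h : R) : 0 <= h -> AN _ a ->
  AN _ (a + h *: (1 *: delta_mx 0 ord_max)).
Proof.
move=> h0 aN i j ij; rewrite !mxE !eqxx /=.
have -> : (i == ord_max) = false.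
  by apply/eqP => im; move: ij; rewrite im ltnNge -ltnS ltn_ord.
have := aN _ _ ij; case: (j == ord_max) => /=; lra.
Qed.

Lemma gamma_neq0 alpha s N m : s * s = 1 -> -1 < cos alpha < 1 ->
  gamma alpha (alternating_row s N) m != 0.
Proof.
move=> ss /andP[c1 c2]; rewrite /gamma mxE.
have : (-1) ^+ m * (-1) ^+ m = 1 :> R by rewrite -expr2 sqrr_sign.
move: ((-1) ^+ m) => z zz; apply/eqP => h.
by have : (s * z) * (s * z) = 1; [rewrite mulrACA ss zz mulr1|nra].
Qed.

Lemma sqr_one_cases s : s * s = 1 -> s = 1 \/ s = -1.
Proof. by move/eqP; rewrite -expr2 sqrf_eq1 => /orP[] /eqP; [left|right]. Qed.

(** The force on the chosen end particle never vanishes, so that there is no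
    equilibrium; it points outwards, so that pushing this particle outwards lowers
    the energy of any configuration. *)
Lemma no_critical_no_minimiser alpha s n (d := alternating_row s n.+2) :
  s * s = 1 -> -1 < cos alpha < 1 ->
  0 <= s * cos alpha \/ 0 <= s * (-1) ^+ n.+1 * cos alpha ->
  (~ exists a, critical_point (W alpha d) a) /\ (~ exists a, minimiser (W alpha d) a).
Proof.
move=> ss c1 H; have g0 m := @gamma_neq0 alpha s n.+2 m ss c1.
have pi0 := pi_gt0 R.
case: H => H; split=> -[a [aN Ha]].
- have := first_force ss H aN.
  have [_ ->] := (critical_pointP a g0).1 (conj aN Ha).
  by rewrite mulr0 ltxx.
- pose v : 'rV[R]_n.+2 := -1 *: delta_mx 0 ord0.
  have aNh (h : R) : 0 <= h -> AN _ (a + h *: v) by move=> h0; exact: AN_first.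
  have := @W_line_decr _ alpha d a v aNh; rewrite ltNge Ha.
    move=> /(_ _)/wrap[]// h h0; rewrite dW_delta.
    have := first_force ss H (aNh _ h0); rewrite -/d.
    have -> : gamma alpha d ord0 = s - cos alpha by rewrite /gamma mxE expr0 mulr1.
    rewrite mulN1r pmulr_rlt0// oppr_lt0.
    move: (total_force _ _ _) => F; case/andP: c1.
    by case: (sqr_one_cases ss) => ->; nra.
  by have := aNh 1 ler01; rewrite scale1r.
- have := last_force ss H aN.
  have [_ ->] := (critical_pointP a g0).1 (conj aN Ha).
  by rewrite mulr0 ltxx.
- pose v : 'rV[R]_n.+2 := 1 *: delta_mx 0 ord_max.
  have aNh (h : R) : 0 <= h -> AN _ (a + h *: v) by move=> h0; exact: AN_last.
  have := @W_line_decr _ alpha d a v aNh; rewrite ltNge Ha.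
    move=> /(_ _)/wrap[]// h h0; rewrite dW_delta.
    have := last_force ss H (aNh _ h0); rewrite -/d => uF.
    have -> : gamma alpha d ord_max = s * (-1) ^+ n.+1 - cos alpha by rewrite /gamma mxE.
    rewrite mul1r pmulr_rlt0//=.
    have : (s * (-1) ^+ n.+1) * (s * (-1) ^+ n.+1) = 1 by rewrite mulrACA ss -expr2 sqrr_sign mulr1.
    move: (total_force _ _ _) (s * (-1) ^+ n.+1) uF => F u uF uu; case/andP: c1.
    by case: (sqr_one_cases uu) uF => ->; nra.
  by have := aNh 1 ler01; rewrite scale1r.
Qed.

End EndParticles.

(** * Clusters of consecutive particles *)

Section Clusters.
Context {R : realType}.
Implicit Types (g A : nat -> R) (F : nat -> nat -> R) (i j m n : nat).

Definition pair_sum F i j : R := \sum_(i <= n < j) \sum_(i <= k < n) F k n.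

Lemma pair_sum_cat F i m j : (i <= m)%N -> (m <= j)%N ->
  pair_sum F i j = pair_sum F i m + pair_sum F m j +
    \sum_(m <= n < j) \sum_(i <= k < m) F k n.
Proof.
move=> im mj; rewrite /pair_sum (@big_cat_nat _ _ _ m)//= -addrA; congr (_ + _).
rewrite -big_split; apply: eq_big_nat => n /andP[mn _].
by rewrite (@big_cat_nat _ _ _ m)//= addrC.
Qed.

Lemma pair_sum1 F i : pair_sum F i i.+1 = 0.
Proof. by rewrite /pair_sum big_nat1 big_geq. Qed.

(** [W] is a constant minus [pi] times this sum; see [W_interaction]. *)
Definition interaction g A i j := pair_sum (fun k n => g k * g n * Iint (A n - A k)) i j.

(** When the particles [i, ..., j - 1] all sit at mutual distances of order [r], their
    interaction is [Iint r * strength g i j] up to a bounded error. So the sign of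
    the strength tells whether they gain energy by collapsing. *)
Definition strength g i j := pair_sum (fun k n => g k * g n) i j.

Lemma exists_max (f : nat -> R) i j : (i.+1 < j)%N ->
  exists2 m, (i < m < j)%N & forall k, (i < k < j)%N -> f k <= f m.
Proof.
elim: j => // j IH; rewrite ltnS leq_eqVlt => /predU1P[<-|ij].
  by exists i.+1 => [|k ik]; [lia|have -> : k = i.+1 by lia].
have [m mij fm] := IH ij; have [fjm|fmj] := leP (f j) (f m).
  exists m; first lia.
  move=> k kij; have [->//|kj] := eqVneq k j; apply: fm; lia.
exists j; first lia.
move=> k kij; have [->//|kj] := eqVneq k j; apply: (le_trans _ (ltW fmj)); apply: fm; lia.
Qed.

Lemma telescope_le A i (G : R) k : (i <= k)%N ->
  (forall l, (i < l <= k)%N -> A l - A l.-1 <= G) -> A k - A i <= (k - i)%:R * G.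
Proof.
elim: k => [|k IH]; first by rewrite leqn0 => /eqP -> _; rewrite subrr mul0r.
rewrite leq_eqVlt => /predU1P[->|ik] H; first by rewrite subrr subnn mul0r.
have h1 : A k.+1 - A k <= G by apply: (H k.+1); lia.
have h2 : A k - A i <= (k - i)%:R * G by apply: IH => // l lk; apply: H; lia.
rewrite subSn// -natr1 mulrDl mul1r; lra.
Qed.

(** Induction on the number of particles. The configuration is cut at its largest
    gap [G]. Two particles on different sides have a distance between [G] and the
    total length, which is at most [l.+1 * G]; by [Iint_drop_le] the kernel at their
    distance may be replaced by its value at the total length, with a bounded error.
    On each side the induction hypothesis gives the kernel at the length of that
    side, which is larger than at the total length; as the strengths are
    nonpositive, it may be replaced too. *)
Lemma cluster_bound g (B : R) N :
  (forall k n, `|g k * g n| <= B) ->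
  (forall i j, (i < j <= N)%N -> strength g i j <= 0) ->
  forall l, exists2 C, 0 <= C & forall A i j, (i < j <= N)%N -> (j <= i + l)%N ->
    (forall k n, (i <= k < n)%N -> (n < j)%N -> A k < A n) ->
    interaction g A i j <= Iint (A j.-1 - A i) * strength g i j + C.
Proof.
move=> gB S0; have B0 : 0 <= B by apply: le_trans (gB 0%N 0%N).
elim=> [|l [C C0 IH]]; first by exists 0 => // A i j; lia.
(* K bounds the error for one pair of particles on different sides of the cut. *)
pose K : R := B * l.+1%:R; have K0 : 0 <= K by rewrite mulr_ge0.
exists (C + C + K * l.+1%:R * l.+1%:R); first by rewrite !addr_ge0 ?mulr_ge0.
move=> A i j ijN jl incr; have [ij|ij] := leqP j i.+1.
  have -> : j = i.+1 by lia.
  by rewrite /interaction /strength !pair_sum1 mulr0 add0r !addr_ge0 ?mulr_ge0.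
have [m mij mmax] := exists_max (fun k => A k - A k.-1) ij.
set G := A m - A m.-1 in mmax; have G0 : 0 < G by rewrite subr_gt0; apply: incr; lia.
pose len := A j.-1 - A i.
have lenG : len <= l.+1%:R * G.
  apply: le_trans (_ : (j.-1 - i)%:R * G <= _).
    by apply: telescope_le => [|k kij]; [lia|apply: mmax; lia].
  by rewrite ler_pM2r// ler_nat; lia.
have incrW k n : (i <= k <= n)%N -> (n < j)%N -> A k <= A n.
  case/andP => ik; rewrite leq_eqVlt => /predU1P[->//|kn] nj.
  by apply/ltW/incr => //; rewrite ik.
have len_ge k n : (i <= k < n)%N -> (n < j)%N -> 0 < A n - A k <= len.
  move=> kn nj; rewrite subr_gt0 incr//= /len.
  have h1 : A i <= A k by apply: incrW; lia.
  have h2 : A n <= A j.-1 by apply: incrW; lia.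
  lra.
have sub i' j' : (i <= i' < j')%N -> (j' <= j)%N -> (j' <= i' + l)%N ->
    interaction g A i' j' <= Iint len * strength g i' j' + C.
  move=> ij' jj' jl'.
  apply: le_trans (IH A i' j' _ jl' _) _; [lia|by move=> k n kn nj; apply: incr; lia|].
  rewrite lerD2r; have [->|ij2] := eqVneq j' i'.+1.
    by rewrite /strength pair_sum1 !mulr0.
  rewrite ler_wnM2r//; first by apply: S0; lia.
  have /andP[h1 h2] : 0 < A j'.-1 - A i' <= len by apply: len_ge; lia.
  exact: Iint_nincr.
have im : (i <= m)%N by lia. have mj : (m <= j)%N by lia.
rewrite /interaction /strength !(pair_sum_cat _ im mj).
rewrite -/(interaction g A i m) -/(interaction g A m j) -/(strength g i m) -/(strength g m j).
have s1 : interaction g A i m <= Iint len * strength g i m + C by apply: sub; lia.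
have s2 : interaction g A m j <= Iint len * strength g m j + C by apply: sub; lia.
suff : \sum_(m <= n < j) \sum_(i <= k < m) g k * g n * Iint (A n - A k) <=
   Iint len * (\sum_(m <= n < j) \sum_(i <= k < m) g k * g n) + K * l.+1%:R * l.+1%:R.
  by rewrite !mulrDr; lra.
apply: le_trans (_ : \sum_(m <= n < j) \sum_(i <= k < m) (Iint len * (g k * g n) + K) <= _).
  apply: ler_sum_nat => n nmj; apply: ler_sum_nat => k kim.
  have /andP[h1 h2] : 0 < A n - A k <= len by apply: len_ge; lia.
  have h3 : G <= A n - A k.
    rewrite /G; have g1 : A m <= A n by apply: incrW; clear -nmj mij; lia.
    have g2 : A k <= A m.-1 by apply: incrW; clear -kim mij; lia.
    lra.
  have h4 : 0 <= Iint (A n - A k) - Iint len by rewrite subr_ge0; exact: Iint_nincr.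
  have h5 : Iint (A n - A k) - Iint len <= l.+1%:R.
    apply: le_trans (Iint_drop_le h1 h2) _; rewrite ler_pdivrMr//.
    apply: le_trans (_ : l.+1%:R * G <= _); last by rewrite ler_pM2l.
    by apply: le_trans lenG; rewrite gerBl ltW.
  have h6 : g k * g n * (Iint (A n - A k) - Iint len) <= K.
    apply: le_trans (ler_norm _) _; rewrite normrM [X in _ * X]ger0_norm//.
    by apply: ler_pM.
  lra.
under eq_bigr => n _ do rewrite big_split /= -mulr_sumr sumr_const_nat.
rewrite big_split /= -mulr_sumr lerD2l sumr_const_nat -mulrnA -[leLHS]mulr_natr natrM -mulrA.
by rewrite ler_wpM2l// ler_pM// ler_nat; lia.
Qed.

(** The particles [i, ..., j - 1] have spacing [e], and two particles that are not
    both in this group have distance at least [1]: [minn k i] moves the particles to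
    the left of the group apart and [maxn k j.-1] those to the right. *)
Lemma collapse_ge g (B : R) N i j (e : R) : (i < j <= N)%N -> 0 < e ->
  (forall k n, `|g k * g n| <= B) ->
  Iint e * strength g i j - B * (N%:R + Iint 1) * N%:R * N%:R <=
  interaction g (fun k => e * k%:R + ((minn k i)%:R + (maxn k j.-1)%:R)) 0 N.
Proof.
move=> ijN e0 gB; have B0 : 0 <= B by apply: le_trans (gB 0%N 0%N).
set A := (fun k : nat => _); have I10 : 0 <= Iint (1 : R) by apply: Iint_ge0.
(* K bounds the error for one pair: pairs inside the group have distances between
   e and N * e, the other ones distances at least 1. *)
pose K := B * (N%:R + Iint 1); have K0 : 0 <= K by rewrite mulr_ge0// addr_ge0.
pose F k n := if (i <= k)%N && (n < j)%N then g k * g n else 0.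
have SF : strength g i j = pair_sum F 0 N.
  rewrite (@pair_sum_cat F 0 j N)//; [|lia]; rewrite (@pair_sum_cat F 0 i j)//; [|lia].
  have Z a b c d : (b <= i)%N || (j <= c)%N -> \sum_(c <= n < d) \sum_(a <= k < b) F k n = 0.
    move=> bc; rewrite big_nat big1// => n ncd; rewrite big_nat big1// => k kab.
    by rewrite /F; case: ifP => //; lia.
  have Z1 : pair_sum F 0 i = 0.
    rewrite /pair_sum big_nat big1// => n ni; rewrite big_nat big1// => k kab.
    by rewrite /F; case: ifP => //; lia.
  have Z2 : pair_sum F j N = 0.
    rewrite /pair_sum big_nat big1// => n ni; rewrite big_nat big1// => k kab.
    by rewrite /F; case: ifP => //; lia.
  rewrite Z1 Z2 !Z ?leqnn ?orbT// !addr0 add0r.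
  apply: eq_big_nat => n nij; apply: eq_big_nat => k kij.
  by rewrite /F ifT//; lia.
rewrite SF; have -> : Iint e * pair_sum F 0 N - K * N%:R * N%:R =
   Iint e * pair_sum F 0 N - \sum_(0 <= n < N) \sum_(0 <= k < N) K.
  by congr (_ - _); rewrite !sumr_const_nat !subn0 -mulrnA -[RHS]mulr_natr natrM mulrA.
apply: le_trans (_ : Iint e * pair_sum F 0 N - pair_sum (fun _ _ => K) 0 N <= _).
  rewrite lerD2l lerN2; apply: ler_sum_nat => n nN.
  rewrite [leRHS](@big_cat_nat _ _ _ n)//=; last lia.
  by rewrite lerDl sumr_ge0.
rewrite /pair_sum mulr_sumr -sumrB; apply: ler_sum_nat => n nN.
rewrite mulr_sumr -sumrB; apply: ler_sum_nat => k kn.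
have nkn : k%:R + 1 <= n%:R :> R by rewrite natr1 ler_nat; lia.
have nN' : n%:R <= N%:R :> R by rewrite ler_nat; lia.
have k0 : 0 <= k%:R :> R by [].
have gB' x : `|x| <= N%:R + Iint 1 -> - K <= g k * g n * x.
  move=> x0; rewrite lerNl; apply: le_trans (ler_norm _) _.
  by rewrite normrN normrM ler_pM.
rewrite /F; case: ifPn => kn'; last first.
  rewrite mulr0 add0r; apply: gB'.
  have m1 : (minn k i)%:R <= (minn n i)%:R :> R by rewrite ler_nat; lia.
  have m2 : (maxn k j.-1)%:R <= (maxn n j.-1)%:R :> R by rewrite ler_nat; lia.
  have m3 : (minn k i)%:R + (maxn k j.-1)%:R + 1 <= (minn n i)%:R + (maxn n j.-1)%:R :> R.
    by rewrite -!natrD natr1 ler_nat; clear -kn kn' ijN nN; lia.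
  have d1 : 1 <= A n - A k by rewrite /A; nra.
  have d0 : 0 < A n - A k by lra.
  rewrite ger0_norm ?Iint_ge0//.
  by have h := Iint_nincr ltr01 d1; rewrite ler_wpDl.
have -> : A n - A k = e * (n%:R - k%:R).
  rewrite /A; have -> : minn k i = minn n i by lia.
  have -> : maxn k j.-1 = maxn n j.-1 by lia.
  ring.
have d1 : e <= e * (n%:R - k%:R) by rewrite ler_peMr ?(ltW e0)//; lra.
have h1 := Iint_nincr e0 d1; have h2 := Iint_drop_le e0 d1.
suff : - K <= g k * g n * (Iint (e * (n%:R - k%:R)) - Iint e) by lra.
apply: gB'; rewrite distrC ger0_norm ?subr_ge0//; apply: le_trans h2 _.
rewrite ler_pdivrMr//; nra.
Qed.

End Clusters.

(** * Strength of alternating clusters and the bounds on the energy *)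

Section Bounds.
Context {R : realType}.
Implicit Types (s c sigma alpha : R) (i m n N : nat).

(** The coefficients [gamma alpha d n] for [c = cos alpha], indexed by [nat] so that
    sums over clusters are sums over intervals. *)
Definition alt_charge s c n : R := s * (-1) ^+ n - c.

(** Closed form for a cluster of [m] particles starting with the sign [sigma], given
    by (sum of the charges)^2 - (sum of their squares). *)
Definition twice_strength m sigma c : R :=
  if odd m then (m%:R - 1) * (m%:R * c ^+ 2 - 2 * sigma * c - 1)
  else m%:R * ((m%:R - 1) * c ^+ 2 - 1).

Lemma strengthE s c i m : s * s = 1 ->
  2 * strength (alt_charge s c) i (i + m) = twice_strength m (s * (-1) ^+ i) c.
Proof.
move=> ss; set sigma := s * (-1) ^+ i; pose g := alt_charge s c.
have sig2 : sigma * sigma = 1 by rewrite /sigma mulrACA ss mul1r -expr2 sqrr_sign.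
have signE n : (-1) ^+ n = 1 - 2 * (odd n)%:R :> R.
  by rewrite -signr_odd; case: (odd n) => /=; rewrite ?expr1 ?expr0; ring.
have gE n : g (i + n)%N = sigma * (1 - 2 * (odd n)%:R) - c.
  by rewrite /g /alt_charge exprD mulrA -signE.
have sumE n : \sum_(i <= k < i + n) g k = sigma * (odd n)%:R - n%:R * c.
  elim: n => [|n IH]; first by rewrite addn0 big_geq// mulr0 mul0r subrr.
  rewrite addnS big_nat_recr ?leq_addr//= IH gE -natr1.
  by case: (odd n) => /=; ring.
have tsE n sg : twice_strength n sg c =
    (sg * (odd n)%:R - n%:R * c) ^+ 2 - (n%:R * (1 + c ^+ 2) - 2 * c * sg * (odd n)%:R)
    + (odd n)%:R * (1 - sg * sg).
  by rewrite /twice_strength; case: (odd n) => /=; ring.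
rewrite tsE sig2 subrr mulr0 addr0.
elim: m => [|m IH]; first by rewrite addn0 /strength /pair_sum big_geq// !mulr0 !mul0r; ring.
rewrite addnS /strength /pair_sum big_nat_recr ?leq_addr//= mulrDr.
rewrite -/(pair_sum (fun k n => g k * g n) i (i + m)) -/(strength g i (i + m)) IH.
rewrite -mulr_suml -/g sumE gE -natr1.
by case: (odd m) => /=; ring: sig2.
Qed.

(** For [c >= 0] the particles of sign [-1] have the larger charges, so that odd
    clusters with both ends negative are the worst ones. If the largest of them, of
    size [A], has nonpositive strength, so have all smaller ones, and the bound
    [A * c ^+ 2 + 2 * c <= 1] also covers the even clusters of size at most [A + 1]
    and those with positive ends of size at most [A + 2]. When [A <= 1], only pairs
    and triples with positive ends remain. *)
Lemma twice_strength_le0 sigma c m A : sigma = 1 \/ sigma = -1 -> 0 <= c <= 1 ->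
  (A <= 1)%N \/ A%:R * c ^+ 2 + 2 * c <= 1 ->
  (m <= A + 2)%N -> (~~ odd m -> (m <= A.+1)%N) -> (odd m -> sigma = -1 -> (m <= A)%N) ->
  (0 < m)%N -> twice_strength m sigma c <= 0.
Proof.
move=> sg /andP[c0 c1] cA mA mev modd m0; rewrite /twice_strength.
have m1 : 0 <= m%:R - 1 :> R by rewrite subr_ge0 ler1n.
case: ifPn => om.
  have [->|m1'] := eqVneq m 1%N; first by rewrite subrr mul0r.
  rewrite mulr_ge0_le0//; have c20 : 0 <= c ^+ 2 by exact: sqr_ge0.
  case: sg => sg; rewrite sg.
    case: cA => cA.
      have h : m%:R <= 3 :> R by rewrite ler_nat; lia.
      nra.
    have h : m%:R <= A%:R + 2 :> R by rewrite -natrD ler_nat.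
    nra.
  case: cA => cA; first by have := modd om sg; case: m m0 m1' {mA mev modd m1 om} => [//|[]//]; lia.
  have h : m%:R <= A%:R :> R by rewrite ler_nat; exact: modd.
  nra.
rewrite mulr_ge0_le0//; have c20 : 0 <= c ^+ 2 by exact: sqr_ge0.
have := mev om => mA'; case: cA => cA.
  have h : m%:R <= 2 :> R by rewrite ler_nat; lia.
  nra.
have h : m%:R <= A%:R + 1 :> R by rewrite natr1 ler_nat.
nra.
Qed.

(** Exchanging the two signs and reflecting [alpha] to [pi - alpha] changes the sign
    of all charges; this reduces negative [cos alpha] to the positive case. *)
Lemma twice_strengthN m sigma c : twice_strength m (- sigma) (- c) = twice_strength m sigma c.
Proof. by rewrite /twice_strength; case: ifP => _; ring. Qed.

(** The cosine of this angle is the positive root of [m * k ^+ 2 + 2 * k = 1], where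
    the strength of an odd cluster of size [m] with negative ends vanishes. *)
Definition collapse_angle m : R := if (m <= 1)%N then 0 else acos ((Num.sqrt m.+1%:R - 1) / m%:R).

Lemma thetaE N : theta R N = collapse_angle (if odd N then N else N.-1).
Proof.
rewrite /theta /collapse_angle; have [N2|N2] := leqP N 2.
  by case: N N2 => [|[|[|]]].
case: ifP => oN; first by rewrite ifF//; lia.
by rewrite ifF ?prednK//; lia.
Qed.

Lemma cos_collapse_angle m (k := cos (collapse_angle m)) : (1 < m)%N ->
  [/\ 0 < k, m%:R * k ^+ 2 + 2 * k = 1 & 0 <= collapse_angle m <= pi].
Proof.
move=> m1; rewrite /k /collapse_angle leqNgt m1 /=.
set r := Num.sqrt _; set x := _ / _.
have m0 : 0 < m%:R :> R by rewrite ltr0n; lia.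
have r2 : r ^+ 2 = m%:R + 1 by rewrite sqr_sqrtr// natr1.
have r0 : 0 <= r by exact: sqrtr_ge0.
have m1' : 1 < m%:R :> R by rewrite ltr1n.
have r1 : 1 < r by nra.
have rm : r - 1 <= m%:R by nra.
have x0 : 0 < x by rewrite divr_gt0 ?subr_gt0.
have x1 : -1 <= x <= 1 by rewrite ler_pdivrMr// mul1r rm andbT; lra.
rewrite acosK ?in_itv//= acos_ge0// acos_lepi//; split => //.
have xE : x * m%:R = r - 1 by rewrite /x divfK// gt_eqF.
have : (m%:R * x ^+ 2 + 2 * x - 1) * m%:R = 0.
  have -> : (m%:R * x ^+ 2 + 2 * x - 1) * m%:R = (x * m%:R) ^+ 2 + 2 * (x * m%:R) - m%:R by ring.
  by rewrite xE; ring: r2.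
by move/eqP; rewrite mulf_eq0 (gt_eqF m0) orbF subr_eq0 => /eqP.
Qed.

Lemma collapse_angle_lt m : collapse_angle m < pi / 2.
Proof.
have [m1|m1] := leqP m 1; first by rewrite /collapse_angle m1 divr_gt0 ?pi_gt0.
have [k0 _ am] := cos_collapse_angle m1; rewrite -ltr_cos ?in_itv//= ?cos_pihalf//.
by have := pi_gt0 R; lra.
Qed.

Lemma cos_stable alpha m : 0 < alpha < pi -> collapse_angle m < alpha -> 0 <= cos alpha ->
  (m <= 1)%N \/ m%:R * cos alpha ^+ 2 + 2 * cos alpha <= 1.
Proof.
move=> api am c0; have [m1|m1] := leqP m 1; [by left|right].
have [k0 kE am'] := cos_collapse_angle m1.
have : cos alpha < cos (collapse_angle m).
  by rewrite ltr_cos// in_itv//=; case/andP: api => /ltW-> /ltW->.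
move=> ck; have : cos alpha ^+ 2 <= cos (collapse_angle m) ^+ 2.
  by rewrite ler_sqr ?nnegrE// ltW.
by move/(ler_wpM2l (ler0n R m)); lra.
Qed.

Lemma cos_unstable alpha m : 0 < alpha < pi -> alpha < collapse_angle m ->
  (1 < m)%N /\ 1 < m%:R * cos alpha ^+ 2 + 2 * cos alpha.
Proof.
move=> api am; have [m1|m1] := leqP m 1.
  by move: am; rewrite /collapse_angle m1; lra.
split=> //; have [k0 kE am'] := cos_collapse_angle m1.
have : cos (collapse_angle m) < cos alpha.
  by rewrite ltr_cos// in_itv//=; case/andP: api => /ltW-> /ltW->.
move=> kc; have : cos (collapse_angle m) ^+ 2 <= cos alpha ^+ 2.
  by rewrite ler_sqr ?nnegrE// ltW// (lt_trans k0).
by move/(ler_wpM2l (ler0n R m)); lra.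
Qed.

(* size of the largest odd cluster starting with sign tau *)

(** Size of the largest odd cluster whose first (and last) particle has sign [tau],
    when the first of the [N] particles has sign [s]. *)
Definition odd_size tau s N := if ~~ odd N then N.-1 else if s == tau then N else (N - 2)%N.

Lemma ThetaE s N : (1 < N)%N -> s = 1 \/ s = -1 ->
  Theta N s = `]collapse_angle (odd_size (-1) s N), pi - collapse_angle (odd_size 1 s N)[%classic.
Proof.
move=> N1 sg; have n11 : (1 == -1 :> R) = false by apply/eqP; lra.
rewrite /Theta !thetaE /odd_size; case: ifPn => oN; first by rewrite (negbTE oN).
have [-> ->] : odd N = true /\ odd (N - 2) = true by lia.
by case: sg => ->; rewrite eqxx ?n11 // eq_sym n11.
Qed.

Lemma odd_size_max tau s N i m : (1 < N)%N -> s = 1 \/ s = -1 -> tau = 1 \/ tau = -1 ->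
  (0 < m)%N -> (i + m <= N)%N ->
  [/\ (m <= odd_size tau s N + 2)%N,
      (~~ odd m -> (m <= (odd_size tau s N).+1)%N) &
      (odd m -> s * (-1) ^+ i = tau -> (m <= odd_size tau s N)%N)].
Proof.
move=> N1 sg tg m0 imN; have n11 : (1 == -1 :> R) = false by apply/eqP; lra.
rewrite /odd_size; case: ifPn => oN; first by split; lia.
rewrite -signr_odd; case: eqP => st; split; try lia.
move=> om si; have : odd i.
  by apply/negPn/negP => oi; apply: st; rewrite -si (negbTE oi) expr0 mulr1.
lia.
Qed.

Lemma odd_size_start tau s N : (1 < N)%N -> s = 1 \/ s = -1 -> tau = 1 \/ tau = -1 ->
  odd (odd_size tau s N) /\ exists2 i, (i + odd_size tau s N <= N)%N & s * (-1) ^+ i = tau.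
Proof.
move=> N1 sg tg; rewrite /odd_size; case: ifPn => oN.
  split; first lia.
  exists (s != tau); first by case: (s != tau) => /=; lia.
  by case: eqP => [->|]; rewrite ?expr0 ?expr1 ?mulr1//=; case: sg tg => -> [] -> //; rewrite ?mulrN1 ?opprK.
case: eqP => st; split; try lia; first by exists 0%N => //; rewrite expr0 mulr1.
exists 1%N; first lia.
by move: st; case: sg tg => -> [] -> //; rewrite ?mulrN1 ?opprK.
Qed.

(** Points of [[l, r]] are approached from inside by moving them towards the
    midpoint. *)
Lemma closure_itvoo (l r x : R) : l < r -> l <= x <= r -> closure `]l, r[%classic x.
Proof.
move=> lr /andP[lx xr] B /nbhs_ballP[e /= e0 eB].
pose m := (l + r) / 2; pose t := Num.min (e / (2 * (r - l))) (1 / 2).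
have t0 : 0 < t by rewrite lt_min divr_gt0 ?mulr_gt0 ?subr_gt0//=; lra.
have t1 : t <= 1 / 2 by rewrite ge_min lexx orbT.
have te : t * (2 * (r - l)) <= e.
  by rewrite -ler_pdivlMr ?mulr_gt0 ?subr_gt0// ge_min lexx.
exists (x + t * (m - x)); split.
  by rewrite /= in_itv/= /m; apply/andP; split; nra.
apply: eB; rewrite /ball/= opprD addNKr normrN normrM gtr0_norm//.
have : `|m - x| <= r - l by rewrite ler_norml /m; lra.
nra.
Qed.

(** When [cos alpha] is negative, the argument for positive cosines applies to
    [pi - alpha] and the opposite signs. *)
Lemma stable_twice_strength_le0 s alpha N i m : (1 < N)%N -> s = 1 \/ s = -1 -> 0 < alpha < pi ->
  Theta N s alpha -> (0 < m)%N -> (i + m <= N)%N ->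
  twice_strength m (s * (-1) ^+ i) (cos alpha) <= 0.
Proof.
move=> N1 sg api; rewrite ThetaE// /= in_itv/= => /andP[al ar] m0 imN.
have sig : s * (-1) ^+ i = 1 \/ s * (-1) ^+ i = -1.
  by apply: sqr_one_cases; rewrite mulrACA -!expr2 sqrr_sign mulr1; case: sg => ->; rewrite ?sqrrN expr1n.
have [c0|c0] := leP 0 (cos alpha).
  have tg : -1 = 1 :> R \/ -1 = -1 :> R by right.
  have [h1 h2 h3] := odd_size_max N1 sg tg m0 imN.
  by apply: twice_strength_le0 (cos_stable api al c0) h1 h2 h3 m0; rewrite ?c0 ?cos_le1.
have tg : 1 = 1 :> R \/ 1 = -1 :> R by left.
have [h1 h2 h3] := odd_size_max N1 sg tg m0 imN.
have cE : cos (pi - alpha) = - cos alpha.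
  by rewrite cosB cospi sinpi mul0r addr0 mulN1r.
rewrite -twice_strengthN -cE.
have c0' : 0 <= cos (pi - alpha) by rewrite cE oppr_ge0 ltW.
have api' : 0 < pi - alpha < pi by lra.
have al' : collapse_angle (odd_size 1 s N) < pi - alpha by lra.
apply: twice_strength_le0 (cos_stable api' al' c0') h1 h2 _ m0.
- by case: sig => ->; [right|left]; rewrite ?opprK.
- by rewrite c0' cos_le1.
- by move=> om /eqP; rewrite eqr_opp => /eqP; exact: h3.
Qed.

Lemma unstable_cluster s alpha N : (1 < N)%N -> s = 1 \/ s = -1 -> 0 < alpha < pi ->
  ~ closure (Theta N s) alpha ->
  exists i m, (0 < m)%N /\ (i + m <= N)%N /\ 0 < twice_strength m (s * (-1) ^+ i) (cos alpha).
Proof.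
move=> N1 sg api; rewrite ThetaE//.
set l := collapse_angle _; set r := collapse_angle _ => ncl.
have l2 : l < pi / 2 := collapse_angle_lt _. have r2 : r < pi / 2 := collapse_angle_lt _.
(* The witness is the largest odd cluster whose ends have sign tau. *)
have key tau : tau = 1 \/ tau = -1 -> (1 < odd_size tau s N)%N ->
    1 < (odd_size tau s N)%:R * cos alpha ^+ 2 - 2 * tau * cos alpha ->
    exists i m, (0 < m)%N /\ (i + m <= N)%N /\ 0 < twice_strength m (s * (-1) ^+ i) (cos alpha).
  move=> tg m1 h; have [om [i iN si]] := odd_size_start N1 sg tg.
  exists i, (odd_size tau s N); split; first exact: ltnW.
  split=> //; rewrite /twice_strength om si mulr_gt0//; first by rewrite subr_gt0 ltr1n.
  lra.
have [al|la] := ltP alpha l.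
  have [m1 h] := cos_unstable api al.
  by apply: (key (-1)) => //; [right|lra].
have [ra|ar] := ltP (pi - r) alpha; last first.
  by exfalso; apply: ncl; apply: closure_itvoo; [lra|rewrite la ar].
have api' : 0 < pi - alpha < pi by lra.
have ra' : pi - alpha < r by lra.
have [m1] := cos_unstable api' ra'.
rewrite cosB cospi sinpi mul0r addr0 mulN1r sqrrN => h.
by apply: (key 1) => //; [left|lra].
Qed.

Lemma alt_charge_le2 s c k n : s = 1 \/ s = -1 -> -1 <= c <= 1 ->
  `|alt_charge s c k * alt_charge s c n| <= 4.
Proof.
move=> sg /andP[c1 c2]; have h m : `|alt_charge s c m| <= 2.
  rewrite /alt_charge -signr_odd ler_norml.
  by case: sg => ->; case: (odd m); rewrite ?expr0 ?expr1; lra.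
by rewrite normrM -[leRHS](_ : 2 * 2 = 4 :> R) ?ler_pM//; ring.
Qed.

Definition position N (a : 'rV[R]_N.+1) (k : nat) : R := a 0 (inord k).

(** Ordered pairs are counted twice in [W], once in [interaction]. *)
Lemma W_interaction s alpha N (a : 'rV[R]_N.+1) :
  W alpha (alternating_row s N.+1) a =
  - (pi / 2) * I0 R * (\sum_(n < N.+1) gamma alpha (alternating_row s N.+1) n ^+ 2)
  - pi * interaction (alt_charge s (cos alpha)) (position a) 0 N.+1.
Proof.
rewrite /W; congr (_ - _); set g := alt_charge _ _.
pose F k n := g k * g n * Iint (position a n - position a k).
have Fsym k n : F k n = F n k.
  by rewrite /F -[position a n - _]opprB Iint_opp [g k * _]mulrC.
transitivity (pi / 2 * \sum_(n < N.+1) \sum_(k < N.+1 | k != n) F k n).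
  congr (_ * _); apply: eq_bigr => n _; apply: eq_bigr => k _.
  by rewrite Iint_norm /F /position !inord_val -opprB Iint_opp /gamma !mxE.
have -> : \sum_(n < N.+1) \sum_(k < N.+1 | k != n) F k n =
    2 * \sum_(n < N.+1) \sum_(k < N.+1 | (k < n)%N) F k n.
  have -> : 2 * \sum_(n < N.+1) \sum_(k < N.+1 | (k < n)%N) F k n =
     \sum_(n < N.+1) \sum_(k < N.+1 | (k < n)%N) F k n +
     \sum_(n < N.+1) \sum_(k < N.+1 | (n < k)%N) F k n.
    rewrite mulrDl mul1r; congr (_ + _).
    rewrite (exchange_big_dep xpredT)//=.
    by apply: eq_bigr => n _; apply: eq_bigr => k _; exact: Fsym.
  rewrite -big_split; apply: eq_bigr => n _ /=.
  rewrite (bigID (fun k : 'I_N.+1 => (k < n)%N)) /=; congr (_ + _); apply: eq_bigl => k.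
    by rewrite -(inj_eq val_inj) /=; lia.
  by rewrite -(inj_eq val_inj) /=; lia.
rewrite mulrA divfK//; congr (_ * _).
rewrite /interaction /pair_sum big_mkord; apply: eq_bigr => n _.
rewrite (big_nat_widen _ _ N.+1); last by rewrite ltnW.
by rewrite big_mkord.
Qed.

Lemma inf_W_gtNy s alpha N : (1 < N)%N -> s = 1 \/ s = -1 -> 0 < alpha < pi ->
  Theta N s alpha -> (-oo < inf_AN (W alpha (alternating_row s N)))%E.
Proof.
case: N => // N N1 sg api th; set g := alt_charge s (cos alpha).
have ss : s * s = 1 by case: sg => ->; ring.
have gB k n : `|g k * g n| <= 4.
  by apply: alt_charge_le2; rewrite // cos_geN1 cos_le1.
have S0 i j : (i < j <= N.+1)%N -> strength g i j <= 0.
  move=> ij; have -> : j = (i + (j - i))%N by lia.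
  rewrite -(@pmulr_rle0 _ 2)// strengthE//; apply: (stable_twice_strength_le0 N1 sg api th); lia.
have [C C0 HC] := cluster_bound gB S0 N.+1.
set V := W _ _.
pose c0 := - (pi / 2) * I0 R * (\sum_(n < N.+1) gamma alpha (alternating_row s N.+1) n ^+ 2).
apply: (@lt_le_trans _ _ (c0 - pi * C)%:E); first exact: ltNyr.
apply/ereal_infP => _ [a aN <-]; rewrite lee_fin /V W_interaction -/c0 lerD2l lerN2.
rewrite ler_pM2l ?pi_gt0//.
have posi k n : (k < n)%N -> (n < N.+1)%N -> position a k < position a n.
  by move=> kn nN; apply: aN; rewrite !inordK// (ltn_trans kn).
have h : interaction g (position a) 0 N.+1 <=
    Iint (position a N - position a 0) * strength g 0 N.+1 + C.
  by apply: HC => [||k n /andP[_]] //; [rewrite ltnS leqnn|exact: posi].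
have S0N : strength g 0 N.+1 <= 0 by apply: S0; rewrite ltnS leqnn.
apply: le_trans h _; rewrite gerDr mulr_ge0_le0//; apply: Iint_ge0; rewrite subr_gt0 posi//.
Qed.

(** A cluster of positive strength collapses: the kernel is unbounded at [0]. *)
Lemma inf_W_eqNy s alpha N i m : s = 1 \/ s = -1 -> (0 < m)%N -> (i + m <= N)%N ->
  0 < twice_strength m (s * (-1) ^+ i) (cos alpha) ->
  inf_AN (W alpha (alternating_row s N)) = -oo%E.
Proof.
case: N => [|N] sg m0 imN; first lia.
have ss : s * s = 1 by case: sg => ->; ring.
rewrite -strengthE// pmulr_rgt0//; set g := alt_charge s (cos alpha) => S0.
have gB k n : `|g k * g n| <= 4.
  by apply: alt_charge_le2; rewrite // cos_geN1 cos_le1.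
pose c0 := - (pi / 2) * I0 R * (\sum_(n < N.+1) gamma alpha (alternating_row s N.+1) n ^+ 2).
pose K : R := 4 * (N.+1%:R + Iint 1) * N.+1%:R * N.+1%:R.
have key M : exists2 a, AN N.+1 a & W alpha (alternating_row s N.+1) a <= M.
  have [e e0 He] := Iint_unbounded ((K + (c0 - M) / pi) / strength g i (i + m)).
  pose A (k : nat) := e * k%:R + ((minn k i)%:R + (maxn k (i + m).-1)%:R) : R.
  exists (\row_(k < N.+1) A k).
    move=> k n kn; rewrite !mxE /A; apply: ltr_leD.
      by rewrite ltr_pM2l// ltr_nat.
    by rewrite -!natrD ler_nat; lia.
  rewrite W_interaction -/c0 -/g.
  have -> : interaction g (position (\row_(k < N.+1) A k)) 0 N.+1 = interaction g A 0 N.+1.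
    apply: eq_big_nat => n nN; apply: eq_big_nat => k kn.
    by rewrite /position !mxE !inordK//; lia.
  have ij : (i < i + m <= N.+1)%N by lia.
  have := collapse_ge ij e0 gB; rewrite -/K -/A.
  move: He; rewrite ler_pdivrMr// => He h.
  have h2 : (c0 - M) / pi <= interaction g A 0 N.+1 by lra.
  by move: h2; rewrite ler_pdivrMr ?pi_gt0// mulrC; lra.
have lb (M : R) : (ereal_inf [set (W alpha (alternating_row s N.+1) a)%:E | a in AN N.+1] <= M%:E)%E.
  have [a aN aM] := key M; apply: (@le_trans _ _ (W alpha (alternating_row s N.+1) a)%:E).
    by apply: ereal_inf_lbound; exists a.
  by rewrite lee_fin.
rewrite /inf_AN; move: (ereal_inf _) lb => [x|//|//] lb; last by have := lb 0.
by have := lb (x - 1); rewrite lee_fin leNgt ltrBlDr ltrDl ltr01.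
Qed.

End Bounds.

(** * Three particles *)

Section ThreeParticles.
Context {R : realType}.
Implicit Types (u v t x : R).

(** Three particles with equal gaps [t] are in equilibrium when [balance u v t = 0],
    where [u = 1 - s * cos alpha] and [v = 1 + s * cos alpha]. *)
Definition balance u v t : R := v * Islope t - u * Islope (2 * t).

(** The scaling [x / 2] comes from rewriting the transform at [2 * t] as a transform
    at [t]. *)
Definition balance_density u v x : R := v * slope_density x - u / 2 * slope_density (2^-1 * x).

Lemma tame_slope_density_half : tame (fun x : R => slope_density (2^-1 * x)).
Proof.
have [cf [M fM]] := @tame_slope_density R; split.
  pose h (y : R) := 2^-1 * y.
  move=> x; apply: (@continuous_comp _ _ _ h (@slope_density R)); last exact: cf.
  by apply: cvgM; [exact: cvg_cst|exact: cvg_id].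
by exists M => x x0; apply: fM; rewrite mulr_gt0.
Qed.

Lemma tame_balance u v : tame (balance_density u v).
Proof.
rewrite (_ : balance_density u v = (fun x => v * slope_density x + - (u / 2) * slope_density (2^-1 * x))).
  by apply: tameD; apply: tameZ; [exact: tame_slope_density|exact: tame_slope_density_half].
by apply/funext => x; rewrite mulNr.
Qed.

Lemma balanceE u v t : 0 < t -> balance u v t = laplace (balance_density u v) t.
Proof.
move=> t0; rewrite /balance /Islope (@laplace_scale _ _ 2)//; first last.
- by move=> x /slope_density_gt0/ltW.
- exact: tame_slope_density.
rewrite laplaceZ//; last exact: tame_slope_density_half.
rewrite /balance_density laplaceB//.
- by rewrite !laplaceZ//; [ring|exact: tame_slope_density_half|exact: tame_slope_density].
- by apply: tameZ; exact: tame_slope_density.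
- by apply: tameZ; exact: tame_slope_density_half.
Qed.

Lemma slope_density_halfE x : slope_density (2^-1 * x) = x ^+ 2 / (4 + x ^+ 2).
Proof.
rewrite /slope_density; have h1 := oneDsqr_gt0 (2^-1 * x); have := sqr_ge0 x => x2.
by field; do ?[apply/andP; split]; apply/lt0r_neq0; nra.
Qed.

(** The sign of the density is that of a quadratic polynomial in [x], which changes
    sign on the half line exactly when [2 * v < u < 8 * v]. *)
Lemma balance_densityE u v x : balance_density u v x =
  x ^+ 2 / ((1 + x ^+ 2) * (4 + x ^+ 2)) * (4 * v - u / 2 - (u / 2 - v) * x ^+ 2).
Proof.
rewrite /balance_density slope_density_halfE /slope_density; have := sqr_ge0 x => x2.
by field; do ?[apply/andP; split]; apply/lt0r_neq0; lra.
Qed.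

Lemma balance_weight_gt0 x : 0 < x -> 0 < x ^+ 2 / ((1 + x ^+ 2) * (4 + x ^+ 2)).
Proof.
by move=> x0; rewrite divr_gt0 ?mulr_gt0 ?ltr_wpDr ?exprn_gt0 ?sqr_ge0.
Qed.

Lemma balance_gt0 u v t : 0 < t -> 0 < u -> u <= 2 * v -> 0 < balance u v t.
Proof.
move=> t0 u0 uv; rewrite balanceE//; apply: laplace_pos => //; first exact: tame_balance.
move=> x x0; rewrite balance_densityE mulr_gt0 ?balance_weight_gt0//.
have := sqr_ge0 x; nra.
Qed.

Lemma balance_lt0 u v t : 0 < t -> 0 < u -> 8 * v <= u -> balance u v t < 0.
Proof.
move=> t0 u0 uv; rewrite -oppr_gt0 balanceE// -mulN1r -laplaceZ//; last exact: tame_balance.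
apply: laplace_pos => //; first by apply: tameZ; exact: tame_balance.
move=> x x0; rewrite mulN1r balance_densityE -mulrN mulr_gt0 ?balance_weight_gt0//.
have := exprn_gt0 2 x0; nra.
Qed.

(** A density with a single change of sign, at [x0], has a transform with at most
    one zero: multiplying the transform at [s] by [expR ((s - t) * x0)] and
    subtracting the one at [t] gives the transform at [t] of the density times
    [expR ((s - t) * (x0 - x)) - 1], a factor that changes sign at [x0] too. *)
Lemma balance_uniq_lt u v t s : u < 8 * v -> 2 * v < u -> 0 < t -> t < s ->
  balance u v t = 0 -> balance u v s <> 0.
Proof.
move=> uv vu t0 ts K1 K2; have s0 := lt_trans t0 ts.
pose x0 := Num.sqrt ((4 * v - u / 2) / (u / 2 - v)).
have q0 : 0 < (4 * v - u / 2) / (u / 2 - v) by apply: divr_gt0; clear -uv vu; lra.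
have x00 : 0 < x0 by rewrite sqrtr_gt0.
have x02 : (u / 2 - v) * x0 ^+ 2 = 4 * v - u / 2.
  by rewrite sqr_sqrtr ?ltW// mulrC divfK//; apply/lt0r_neq0; clear -vu; lra.
have vu' : 0 < u / 2 - v by clear -vu; lra.
pose d := s - t; have d0 : 0 < d by rewrite subr_gt0.
pose psi := balance_density u v.
have tpsi : tame psi by exact: tame_balance.
have tpe : tame (fun x => psi x * expR (- (d * x))).
  by apply: tameM => //; apply: tame_expR; exact: ltW.
pose F x := expR (d * x0) * (psi x * expR (- (d * x))) - psi x.
have FE x : F x = x ^+ 2 / ((1 + x ^+ 2) * (4 + x ^+ 2)) *
    ((u / 2 - v) * (x0 ^+ 2 - x ^+ 2) * (expR (d * (x0 - x)) - 1)).
  have -> : expR (d * (x0 - x)) = expR (d * x0) * expR (- (d * x)).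
    by rewrite -expRD; congr expR; ring.
  by rewrite /F /psi balance_densityE -x02; ring.
have L0 : laplace F t = 0.
  rewrite /F laplaceB//; last exact: tameZ.
  have Kt : laplace psi t = 0 by rewrite -balanceE.
  have Ks : laplace psi s = 0 by rewrite -balanceE.
  by rewrite laplaceZ// laplace_shift /d subrK Kt Ks mulr0 subrr.
have : 0 < laplace F t.
  apply: (@laplace_gt0 _ _ _ x0) => //.
  - rewrite (_ : F = (fun x => expR (d * x0) * (psi x * expR (- (d * x))) + -1 * psi x)).
      by apply: tameD; apply: tameZ.
    by apply/funext => x; rewrite mulN1r.
  - move=> x xp; rewrite FE mulr_ge0 ?(ltW (balance_weight_gt0 _))//.
    have [xx0|x0x] := leP x x0.
      apply: mulr_ge0; last by rewrite subr_ge0 -expR0 ler_expR pmulr_rge0// subr_ge0.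
      by rewrite mulr_ge0 ?(ltW vu') ?subr_ge0// ler_sqr ?nnegrE ?(ltW xp) ?(ltW x00).
    apply: mulr_le0; last by rewrite subr_le0 -expR0 ler_expR pmulr_rle0// subr_le0 ltW.
    rewrite mulr_ge0_le0 ?(ltW vu')// subr_le0.
    by rewrite ler_sqr ?nnegrE ?(ltW xp) ?(ltW x00) ?(ltW x0x).
  - move=> x /andP[xp xx0]; rewrite FE mulr_gt0 ?balance_weight_gt0//.
    apply: mulr_gt0; last by rewrite subr_gt0 -expR0 ltr_expR mulr_gt0 ?subr_gt0.
    by rewrite mulr_gt0// subr_gt0 ltr_sqr ?nnegrE ?(ltW xp) ?(ltW x00).
by rewrite L0 ltxx.
Qed.

Lemma balance_uniq u v t s : u < 8 * v -> 2 * v < u -> 0 < t -> 0 < s ->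
  balance u v t = 0 -> balance u v s = 0 -> t = s.
Proof.
move=> uv vu t0 s0 K1 K2; have [ts|st|//] := ltgtP t s.
  by case: (balance_uniq_lt uv vu t0 ts K1 K2).
by case: (balance_uniq_lt uv vu s0 st K2 K1).
Qed.

(** Near [0] the transform is governed by the limit [- b] of the density at infinity.
    The density is at most [- b / 2] beyond a point [X], and the rest is majorised by
    a multiple of [expR (- x)], whose transform stays bounded. *)
Lemma balance_neg_near0 u v : 2 * v < u -> 0 < v ->
  exists2 t, 0 < t & balance u v t < 0.
Proof.
move=> vu v0; pose b := u / 2 - v; have b0 : 0 < b by rewrite /b; lra.
have u0 : 0 < u by lra.
(* For x >= X the density exceeds its limit - b by at most
   2 u / (4 + x^2) <= b / 2. *)
pose X := 4 * u / b + 1.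
have X1 : 0 < 4 * u / b by rewrite divr_gt0//; lra.
have Xb : (X - 1) * b = 4 * u by rewrite /X addrK divfK// gt_eqF.
pose C := (v + b / 2) * expR X.
have C0 : 0 < C by rewrite mulr_gt0 ?expR_gt0//; lra.
(* This makes C / (1 + t) smaller than (b / 2) / t = C. *)
pose t := b / (2 * C); have t0 : 0 < t by rewrite divr_gt0// mulr_gt0.
have tC : t * C = b / 2 by rewrite /t; field; rewrite gt_eqF.
exists t => //; rewrite balanceE//.
apply: le_lt_trans (_ : laplace (exp_poly (- (b / 2)) C 0 0) t < 0).
  apply: le_laplace => //; [exact: tame_balance|exact: tame_exp_poly|].
  move=> x x0; rewrite /exp_poly !mul0r !addr0 mul1r /balance_density slope_density_halfE.
  have xx := sqr_ge0 x.
  have f1 : v * slope_density x <= v by rewrite ler_piMr ?(ltW v0)// slope_density_le1.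
  have f2 : 0 <= u / 2 * (x ^+ 2 / (4 + x ^+ 2)).
    by rewrite !mulr_ge0 ?invr_ge0//; lra.
  have [xX|Xx] := leP x X.
    have : (v + b / 2) <= C * expR (- x).
      rewrite /C -mulrA -expRD ler_peMr//; first lra.
      by rewrite -expR0 ler_expR subr_ge0.
    lra.
  have h : x ^+ 2 / (4 + x ^+ 2) = 1 - 4 / (4 + x ^+ 2) by field; apply/lt0r_neq0; lra.
  have : u / 2 * (4 / (4 + x ^+ 2)) <= b / 2.
    rewrite mulrA ler_pdivrMr; last lra.
    have X2 : (X - 1) * b <= x ^+ 2 * b by rewrite ler_pM2r//; nra.
    nra.
  have : 0 <= C * expR (- x) by rewrite mulr_ge0 ?expR_ge0 ?ltW.
  rewrite h /b; move: (C * _) => z; move: f1; rewrite /b; lra.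
rewrite laplace_exp_poly// !mul0r !addr0 mulNr addrC subr_lt0.
rewrite ltr_pdivrMr ?ltr_wpDr ?(ltW t0)// -(ltr_pM2l t0) tC.
have -> : t * (b / 2 / t * (1 + t)) = b / 2 * (1 + t) by field; rewrite gt_eqF.
nra.
Qed.

(** At infinity the transform is governed by the density near [0], which is
    equivalent to [c * x ^+ 2]. In terms of [y = 1 - expR (- x)], which satisfies
    [y <= x <= y / (1 - y)], the density is at least [c * y ^+ 2 - C * y ^+ 3], an
    exponential polynomial. *)
Lemma balance_pos_atinfty u v : u < 8 * v -> 0 < u ->
  exists T, forall t, 0 < t -> T <= t -> 0 < balance u v t.
Proof.
move=> uv u0; pose c := v - u / 8; pose C := v + 5 * u / 4.
have c0 : 0 < c by rewrite /c; lra.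
have v0 : 0 < v by lra.
exists (3 * C / c) => t t0; rewrite ler_pdivrMr// => Tt; rewrite balanceE//.
apply: lt_le_trans (_ : laplace (exp_poly (c - C) (3 * C - 2 * c) (c - 3 * C) C) t <= _).
  rewrite laplace_exp_poly//.
  have -> : (c - C) / t + ((3 * C - 2 * c) / (1 + t) + ((c - 3 * C) / (2 + t) + C / (3 + t))) =
     (2 * (c * (t + 3) - 3 * C)) / (t * (1 + t) * (2 + t) * (3 + t)).
    by field; rewrite !gt_eqF//; lra.
  by rewrite divr_gt0// ?mulr_gt0//; lra.
apply: le_laplace => //; [exact: tame_exp_poly|exact: tame_balance|].
move=> x x0; rewrite exp_polyE /balance_density slope_density_halfE; set y := 1 - expR (- x).
have E0 : 0 < expR (- x) := expR_gt0 _.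
have y0 : 0 < y by rewrite subr_gt0 -expR0 ltr_expR oppr_lt0.
have y1 : y < 1 by rewrite /y; lra.
have yx : y <= x by have := expR_ge1Dx (- x); rewrite /y; lra.
have xy : x * (1 - y) <= y.
  have := expR_ge1Dx x; rewrite -(ler_pM2r E0) -expRD subrr expR0 /y; lra.
have xx := sqr_ge0 x.
have y2x2 : y ^+ 2 <= x ^+ 2 by rewrite ler_sqr ?nnegrE ?(ltW y0) ?(ltW x0).
have y1' : 0 <= 1 - y by rewrite subr_ge0 ltW.
have h1 : y ^+ 2 - y ^+ 3 <= slope_density x.
  rewrite /slope_density ler_pdivlMr ?oneDsqr_gt0//.
  have k1 : 0 <= 1 - y ^+ 2 + y ^+ 3 by nra.
  have k2 : y ^+ 2 * (1 - y ^+ 2 + y ^+ 3) <= x ^+ 2 * (1 - y ^+ 2 + y ^+ 3).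
    by rewrite ler_wpM2r.
  have k3 : 0 <= y ^+ 2 * (y * (1 - y) ^+ 2 + 0) by rewrite mulr_ge0 ?sqr_ge0// addr0 mulr_ge0 ?sqr_ge0// ltW.
  have k4 : 0 <= y ^+ 2 * y * (1 - y + y ^+ 2) by rewrite !mulr_ge0 ?sqr_ge0 ?(ltW y0)//; nra.
  nra.
have h2 : x ^+ 2 / (4 + x ^+ 2) <= y ^+ 2 / 4 + 5 / 2 * y ^+ 3.
  rewrite ler_pdivrMr; last lra.
  have k1 : (x * (1 - y)) ^+ 2 <= y ^+ 2.
    by rewrite ler_sqr ?nnegrE ?(ltW y0) ?mulr_ge0 ?(ltW x0).
  have k2 : x ^+ 2 * (1 - y) ^+ 2 * (1 + 10 * y) <= y ^+ 2 * (1 + 10 * y).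
    by rewrite -exprMn ler_wpM2r//; lra.
  have k3 : 0 <= y * (8 - 75 / 4 * y + 25 / 2 * y ^+ 2).
    by rewrite mulr_ge0 ?(ltW y0)//; have := sqr_ge0 (y - 3 / 4); rewrite sqrrB; lra.
  have k4 : 0 <= x ^+ 2 * (y * (8 - 75 / 4 * y + 25 / 2 * y ^+ 2)) by rewrite mulr_ge0.
  nra.
have g1 : v * (y ^+ 2 - y ^+ 3) <= v * slope_density x by rewrite ler_pM2l.
have g2 : u / 2 * (x ^+ 2 / (4 + x ^+ 2)) <= u / 2 * (y ^+ 2 / 4 + 5 / 2 * y ^+ 3).
  by rewrite ler_pM2l//; lra.
rewrite /c /C; lra.
Qed.

Lemma balance_root u v : u < 8 * v -> 2 * v < u -> exists2 t, 0 < t & balance u v t = 0.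
Proof.
move=> uv vu; have v0 : 0 < v by lra.
have [a a0 Ka] := balance_neg_near0 vu v0.
have u0 : 0 < u by lra.
have [T HT] := balance_pos_atinfty uv u0.
pose b := a + `|T|; have ab : a <= b by rewrite lerDl.
have b0 : 0 < b by exact: lt_le_trans ab.
have Kb : 0 < balance u v b.
  apply: HT => //.
  by rewrite /b; have := ler_norm T; lra.
have cK : {within `[a, b], continuous (laplace (balance_density u v))}.
  apply: derivable_within_continuous => x; rewrite in_itv/= => /andP[ax _].
  by have [] := is_derive_laplace (lt_le_trans a0 ax) (tame_balance u v).
have [|t] := @IVT R _ a b 0 ab cK.
  rewrite -(balanceE u v a0) -(balanceE u v b0).
  by rewrite ge_min le_max; apply/andP; split; apply/orP; [left|right]; exact: ltW.
rewrite in_itv/= => /andP[at_ _] Kt; exists t; first exact: lt_le_trans at_.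
by rewrite balanceE// (lt_le_trans a0 at_).
Qed.

(** Equilibrium of the two end particles, with gaps [x] and [y]. *)
Definition balanced u v (x y : R) :=
  v * Islope x = u * Islope (x + y) /\ v * Islope y = u * Islope (x + y).

(** As the slope of the kernel is strictly monotone, both gaps agree. *)
Lemma balanced_eq u v x y : 0 < v -> 0 < x -> 0 < y -> balanced u v x y ->
  x = y /\ balance u v x = 0.
Proof.
move=> v0 x0 y0 [h1 h2]; have xy : x = y.
  exact: (Islope_inj x0 y0 (mulfI (lt0r_neq0 v0) (etrans h1 (esym h2)))).
rewrite -xy in h1 *; split=> //; by rewrite /balance h1 mulr2n mulrDl mul1r subrr.
Qed.

Definition ord30 : 'I_3 := Ordinal (isT : 0 < 3)%N.
Definition ord31 : 'I_3 := Ordinal (isT : 1 < 3)%N.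
Definition ord32 : 'I_3 := Ordinal (isT : 2 < 3)%N.

Lemma ord3_cases (P : 'I_3 -> Prop) : P ord30 -> P ord31 -> P ord32 -> forall m, P m.
Proof.
move=> P0 P1 P2 [[|[|[|//]]] m3].
- by rewrite (_ : Ordinal m3 = ord30)//; exact: val_inj.
- by rewrite (_ : Ordinal m3 = ord31)//; exact: val_inj.
- by rewrite (_ : Ordinal m3 = ord32)//; exact: val_inj.
Qed.

Lemma sum_others3 (f : 'I_3 -> R) :
  [/\ \sum_(k < 3 | k != ord30) f k = f ord31 + f ord32,
      \sum_(k < 3 | k != ord31) f k = f ord30 + f ord32 &
      \sum_(k < 3 | k != ord32) f k = f ord30 + f ord31].
Proof.
have E0 : ord0 = ord30 by exact: val_inj.
have E1 : lift ord0 ord0 = ord31 by exact: val_inj.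
have E2 : lift ord0 (lift ord0 ord0) = ord32 by exact: val_inj.
by split; rewrite big_mkcond !big_ord_recl big_ord0 E1 E2 E0 /= ?add0r ?addr0.
Qed.

(** The middle particle is in equilibrium when the two gaps agree, so that its
    equation follows from those of the end particles. *)
Lemma force_balance3 s alpha (a : 'rV[R]_3)
    (x := a 0 ord31 - a 0 ord30) (y := a 0 ord32 - a 0 ord31) :
  s * s = 1 -> 0 < 1 + s * cos alpha -> AN 3 a ->
  (forall m, total_force (gamma alpha (alternating_row s 3)) a m = 0) <->
  balanced (1 - s * cos alpha) (1 + s * cos alpha) x y.
Proof.
move=> ss v0 aN; set g := gamma alpha _.
have [g0 g1 g2] : [/\ g ord30 = s - cos alpha, g ord31 = - s - cos alpha & g ord32 = s - cos alpha].
  by rewrite /g /gamma !mxE /= expr0 expr1 sqrrN expr1n !mulr1 mulrN1.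
have x0 : 0 < x by rewrite subr_gt0 aN.
have y0 : 0 < y by rewrite subr_gt0 aN.
have xy0 : 0 < x + y by exact: addr_gt0.
have Fx : force (a 0 ord31 - a 0 ord30) = Islope x by exact: force_gt0E.
have Fy : force (a 0 ord32 - a 0 ord31) = Islope y by exact: force_gt0E.
have Fxy : force (a 0 ord32 - a 0 ord30) = Islope (x + y).
  by rewrite -(force_gt0E xy0) /x /y; congr force; ring.
have FN i j : force (a 0 i - a 0 j) = - force (a 0 j - a 0 i).
  by rewrite -force_opp opprB.
have F0 : s * total_force g a ord30 =
    (1 + s * cos alpha) * Islope x - (1 - s * cos alpha) * Islope (x + y).
  have [E _ _] := sum_others3 (fun k => g k * force (a 0 ord30 - a 0 k)).
  by rewrite /total_force E g1 g2 (FN ord30 ord31) (FN ord30 ord32) Fx Fxy; ring: ss.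
have F1 : total_force g a ord31 = (s - cos alpha) * (Islope x - Islope y).
  have [_ E _] := sum_others3 (fun k => g k * force (a 0 ord31 - a 0 k)).
  by rewrite /total_force E g0 g2 (FN ord31 ord32) Fx Fy; ring.
have F2 : s * total_force g a ord32 =
    (1 - s * cos alpha) * Islope (x + y) - (1 + s * cos alpha) * Islope y.
  have [_ _ E] := sum_others3 (fun k => g k * force (a 0 ord32 - a 0 k)).
  by rewrite /total_force E g0 g1 Fxy Fy; ring: ss.
have s0 : s != 0 by apply/eqP => z; move: ss; rewrite z mulr0 => /esym/eqP; rewrite oner_eq0.
split=> [H|[h1 h2]].
  by rewrite !H mulr0 in F0 F2; split; apply/eqP; rewrite -subr_eq0 -?F0 // -opprB -F2 oppr0.
apply: ord3_cases.
- by apply: (mulfI s0); rewrite F0 h1 subrr mulr0.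
- by rewrite F1 (mulfI (lt0r_neq0 v0) (etrans h1 (esym h2))) subrr mulr0.
- by apply: (mulfI s0); rewrite F2 h2 subrr mulr0.
Qed.

(** The critical point is not a minimiser because the cluster of all three particles
    has positive strength when [s * cos alpha < - 1 / 3]: the energy is unbounded
    below. *)
Lemma three_critical s alpha : s = 1 \/ s = -1 -> -1 < cos alpha < 1 ->
  - (7 / 9) < s * cos alpha < - (1 / 3) ->
  exists a : 'rV[R]_3,
    [/\ critical_point (W alpha (alternating_row s 3)) a,
        forall b : 'rV[R]_3, critical_point (W alpha (alternating_row s 3)) b ->
          exists t : R, b = a + const_mx t
      & ~ minimiser (W alpha (alternating_row s 3)) a].
Proof.
move=> sg c1 /andP[e1 e2]; have ss : s * s = 1 by case: sg => ->; ring.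
have g0 m := @gamma_neq0 R alpha s 3 m ss c1.
set e := s * cos alpha in e1 e2.
have v0 : 0 < 1 + e by lra.
have uv : 1 - e < 8 * (1 + e) by lra.
have vu : 2 * (1 + e) < 1 - e by lra.
have [t t0 Kt] := balance_root uv vu.
have crit (b : 'rV[R]_3) : critical_point (W alpha (alternating_row s 3)) b ->
    b 0 ord31 = b 0 ord30 + t /\ b 0 ord32 = b 0 ord30 + t + t.
  move/(critical_pointP b g0) => -[bN /(force_balance3 ss v0 bN) bal].
  have x0 : 0 < b 0 ord31 - b 0 ord30 by rewrite subr_gt0 bN.
  have y0 : 0 < b 0 ord32 - b 0 ord31 by rewrite subr_gt0 bN.
  have [xy Kx] := balanced_eq v0 x0 y0 bal.
  have xt := balance_uniq uv vu x0 t0 Kx Kt.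
  by clear -xy xt; split; lra.
pose a : 'rV[R]_3 := \row_(k < 3) (k%:R * t).
exists a; have aE k : a 0 k = k%:R * t by rewrite mxE.
have aN : AN 3 a by move=> i j ij; rewrite !mxE ltr_pM2r// ltr_nat.
have acrit : critical_point (W alpha (alternating_row s 3)) a.
  apply/(critical_pointP a g0); split=> //; apply/(force_balance3 ss v0 aN).
  rewrite !aE /= -/e /balanced; have -> : 1 * t - 0 * t = t by ring.
  have -> : 2 * t - 1 * t = t by ring.
  have -> : t + t = 2 * t by ring.
  by have E := subr0_eq Kt; split; exact: E.
split=> //.
- move=> b /crit[b1 b2]; exists (b 0 ord30); apply/rowP; apply: ord3_cases; rewrite !mxE /=.
  + by rewrite mul0r add0r.
  + by rewrite b1 mul1r addrC.
  + by rewrite b2; ring.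
- case=> _ amin.
  have infE : inf_AN (W alpha (alternating_row s 3)) = -oo%E.
    apply: (@inf_W_eqNy R s alpha 3 0 3) => //; rewrite expr0 mulr1 /twice_strength /=.
    have cc : cos alpha ^+ 2 = e ^+ 2 by rewrite /e exprMn (expr2 s) ss mul1r.
    have -> : 2 * s * cos alpha = 2 * e by rewrite mulrA.
    rewrite cc; clear -e1 e2; nra.
  have : ((W alpha (alternating_row s 3) a)%:E <= inf_AN (W alpha (alternating_row s 3)))%E.
    by apply/ereal_infP => _ [b bN <-]; rewrite lee_fin; exact: amin.
  by rewrite infE leeNy_eq.
Qed.

Lemma three_no_critical s alpha : s = 1 \/ s = -1 -> -1 < cos alpha < 1 ->
  ~ (- (7 / 9) < s * cos alpha < - (1 / 3)) ->
  ~ exists a : 'rV[R]_3, critical_point (W alpha (alternating_row s 3)) a.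
Proof.
move=> sg c1 ne [a]; have ss : s * s = 1 by case: sg => ->; ring.
have g0 m := @gamma_neq0 R alpha s 3 m ss c1.
have [v0 u0] : 0 < 1 + s * cos alpha /\ 0 < 1 - s * cos alpha.
  by case/andP: c1 => k1 k2; clear -sg k1 k2; case: sg => ->; split; rewrite ?mul1r ?mulN1r; lra.
move/(critical_pointP a g0) => -[aN /(force_balance3 ss v0 aN) bal].
have x0 : 0 < a 0 ord31 - a 0 ord30 by rewrite subr_gt0 aN.
have y0 : 0 < a 0 ord32 - a 0 ord31 by rewrite subr_gt0 aN.
have [_ Kx] := balanced_eq v0 x0 y0 bal.
have [e1|e1] := leP (s * cos alpha) (- (7 / 9)).
  have h : 8 * (1 + s * cos alpha) <= 1 - s * cos alpha by clear -e1; lra.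
  by have := balance_lt0 x0 u0 h; rewrite Kx ltxx.
have [e2|e2] := leP (- (1 / 3)) (s * cos alpha).
  have h : 1 - s * cos alpha <= 2 * (1 + s * cos alpha) by clear -e2; lra.
  by have := balance_gt0 x0 u0 h; rewrite Kx ltxx.
by apply: ne; rewrite e1 e2.
Qed.

End ThreeParticles.

(** * Alternating signs and the four statements *)

Lemma alternating_rowE (R : realType) N (d : 'rV[R]_N) : d = alt_plus R N \/ d = alt_minus R N ->
  exists2 s, s = 1 \/ s = -1 & d = alternating_row s N.
Proof.
case=> ->; [exists 1; [by left|]|exists (-1); [by right|]];
  by apply/rowP => n; rewrite !mxE ?mul1r ?exprS.
Qed.

Lemma cos_lt1 (R : realType) (alpha : R) : 0 < alpha < pi -> -1 < cos alpha < 1.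
Proof.
move=> /andP[a0 api]; have p0 := pi_gt0 R.
rewrite -{1}cospi -cos0 !ltr_cos ?in_itv//= ?lexx ?(ltW a0) ?(ltW p0) ?(ltW api)//.
by rewrite a0 api.
Qed.

Theorem proposition9 (R : realType) (alpha : R) (N : nat) (hN : (1 < N)%N)
    (d : 'rV[R]_N)
    (halpha : 0 < alpha < pi)
    (hd : d = alt_plus R N \/ d = alt_minus R N) :
  let d1 := d 0 (fst_idx hN) in
  let dN := d 0 (lst_idx hN) in
  [/\ (* 1 *)
      Theta N d1 alpha -> (-oo < inf_AN (W alpha d))%E,
      (* 2 *)
      (3 <= N)%N -> ~ closure (Theta N d1) alpha ->
        inf_AN (W alpha d) = -oo%E,
      (* 3 *)
      N = 3%N ->
        (- (7 / 9) < d1 * cos alpha < - (1 / 3) ->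
           exists a : 'rV[R]_N,
             [/\ critical_point (W alpha d) a,
                 forall b : 'rV[R]_N, critical_point (W alpha d) b ->
                   exists t : R, b = a + const_mx t
               & ~ minimiser (W alpha d) a]) /\
        (~ (- (7 / 9) < d1 * cos alpha < - (1 / 3)) ->
           ~ exists a : 'rV[R]_N, critical_point (W alpha d) a)
    & (* 4 *)
      (0 <= d1 * cos alpha \/ 0 <= dN * cos alpha ->
         (~ exists a : 'rV[R]_N, critical_point (W alpha d) a) /\
         (~ exists a : 'rV[R]_N, minimiser (W alpha d) a)) /\
      (~~ odd N ->
         [/\ 0 <= d1 * cos alpha \/ 0 <= dN * cos alpha,
             ~ exists a : 'rV[R]_N, critical_point (W alpha d) a
           & ~ exists a : 'rV[R]_N, minimiser (W alpha d) a])].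
Proof.
have [s sg ->] := alternating_rowE hd; have c1 := cos_lt1 halpha.
have ss : s * s = 1 by case: sg => ->; ring.
move=> d1 dN.
have d1E : d1 = s by rewrite /d1 mxE expr0 mulr1.
have dNE : dN = s * (-1) ^+ N.-1 by rewrite /dN mxE lst_idxE.
rewrite d1E dNE; clear d1 dN d1E dNE hd d.
have ends : 0 <= s * cos alpha \/ 0 <= s * (-1) ^+ N.-1 * cos alpha ->
   (~ exists a, critical_point (W alpha (alternating_row s N)) a) /\
   (~ exists a, minimiser (W alpha (alternating_row s N)) a).
  case: N hN => [//|[//|n]] _; exact: no_critical_no_minimiser.
split.
- exact: inf_W_gtNy.
- move=> _ ncl; have [i [m [m0 [imN S0]]]] := unstable_cluster hN sg halpha ncl.
  exact: inf_W_eqNy S0.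
- move=> N3; clear ends; subst N; split; [exact: three_critical|exact: three_no_critical].
- split=> // oN.
  have H : 0 <= s * cos alpha \/ 0 <= s * (-1) ^+ N.-1 * cos alpha.
    have [|sc] := leP 0 (s * cos alpha); [by left|right].
    rewrite -signr_odd (_ : odd N.-1 = true); last by lia.
    by rewrite expr1 mulrN1 mulNr oppr_ge0 ltW.
  by have [? ?] := ends H.
Qed.
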